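(* Consider the SDDP algorithm described in the context, applied to the risk-averse multistage stochastic program described there. When the basic optimal solutions are employed in the backward steps, the forward step procedure generates the optimal solution for the risk-averse multistage stochastic program with probability one after a sufficiently large number of backward and forward steps of the algorithm.
   Context: **Problem.** Let $T$ be the number of stages. For $t=2,\dots,T$ the data $(c_t,b_t,A_t,B_t)$ depend on a stagewise independent random parameter $\xi_t$ with finite set of scenarios $\Omega_t=\{\xi_{t1},\dots,\xi_{tN_t}\}$ generated from historical data. Let $f_0$ be the reference (empirical) distribution on $\Omega_t$ and $d_t$ a tolerance. The ambiguity set is $\mathcal D^t=\{f\ge0:\|f-f_0\|_\infty\le d_t,\ \sum_i f^i=1\}$. The risk-averse multistage stochastic program (RMSP) is $$\min_{A_1x_1\ge b_1}c_1x_1+\sup_{\mathbb P_2\in\mathcal D^2}\mathbb E_{\mathbb P_2}\Big[\min_{A_2x_2\ge b_2-B_2x_1}c_2x_2+\cdots+\sup_{\mathbb P_T\in\mathcal D^T}\mathbb E_{\mathbb P_T}\big[\min_{A_Tx_T\ge b_T-B_Tx_{T-1}}c_Tx_T\big]\Big].$$ Standing assumption: the RMSP has compact feasible set and relatively complete recourse, and the recourse function at each stage is bounded for each decision $x$. Put $f_\ell=f_0-d_t$, $f_u=f_0+d_t$, $P_t^\ell=\sum_i f_\ell^i$, $P_t^u=\sum_i f_u^i$, and assume $P_t^\ell\in(0,1)$, $P_t^u>1$. Let $(p_{ti}^\ell)_i$ and $(p_{ti}^{u-\ell})_i$ be the scenario probabilities under the two reference probability measures $\mathbb P_t^\ell$,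 $\mathbb P_t^{u-\ell}$ induced by $f_\ell$ and $f_u-f_\ell$ (i.e. these vectors normalized). Set $\hat{\mathcal Q}_{T+1}=0$ and $P_{T+1}^u=P_{T+1}^\ell=1$. The RMSP is equivalently reformulated as $$\min_{x_1,u_1}\{c_1x_1+(1-P_2^\ell)u_1+\hat{\mathcal Q}_2(x_1,u_1):A_1x_1\ge b_1\},$$ where, for $t=2,\dots,T$ and $i=1,\dots,N_t$, $$\hat Q_{ti}(\bar x_{t-1})=\inf_{x_t,u_t}\{c_t(\xi_{ti})x_t+(1-P_{t+1}^\ell)u_t+\hat{\mathcal Q}_{t+1}(x_t,u_t):A_t(\xi_{ti})x_t\ge b_t(\xi_{ti})-B_t(\xi_{ti})\bar x_{t-1}\},$$ $$\hat{\mathcal Q}_t(x_{t-1},u_{t-1})=P_t^\ell\sum_{i=1}^{N_t}p_{ti}^\ell\hat Q_{ti}(x_{t-1})+(P_t^u-P_t^\ell)\sum_{i=1}^{N_t}p_{ti}^{u-\ell}[\hat Q_{ti}(x_{t-1})-u_{t-1}]^+,$$ with $u_t\in\mathbb R$ and $[a]^+=\max\{a,0\}$. **Approximate problems.** The algorithm maintains approximations $\mathfrak Q_t$ of the convex functions $\hat{\mathcal Q}_t$, with $\mathfrak Q_{T+1}=0$. The approximate first-stage problem, and the approximate stage-$t$ problem for $(\bar x_{t-1},\xi_{ti})$, are the problems above with $\hat{\mathcal Q}_{t+1}$ replaced by $\mathfrak Q_{t+1}$. In the backward recursion, $\hat Q_{ti}(\bar x_{t-1})$ denotes the optimal value of the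 approximate stage-$t$ problem, and $\hat{\mathcal Q}_t$ is evaluated by the formula above with these values. **Algorithm (SDDP).** Initialization: $\mathfrak Q_t=0$ for $t=2,\dots,T$, $\bar z=\infty$, $k=0$. Given are an optimality tolerance $\varepsilon$, an iteration limit $K$, sample numbers $M_t$ ($M$ is the number of samples $z_i$ below), and the normal score $z_{\alpha/2}$. 1. Solve the approximate first-stage problem; let $(\hat x_1,\hat u_1)$ be the optimal solution. 2. Let the lower bound $\underline z$ be the optimal value of the approximate first-stage problem with the current $\mathfrak Q_2$ (its solution being the current $(\hat x_1,\hat u_1)$). If $\bar z+\frac{z_{\alpha/2}}{\sqrt{M-1}}\sum_{i=1}^M(z_i-\bar z)^2-\underline z\le\varepsilon\underline z$ or $k>K$, stop; otherwise continue. 3. Forward simulation: for $t=2,\dots,T$ and $i=1,\dots,M_t$, sample $\xi_{ti}$ from $\Omega_t$ (samples are independent), solve the approximate stage-$t$ problem for sample $i$ at the preceding forward solution ($\hat x_{t-1,i}$, or $\hat x_1$ if $t=2$), and store the optimal solution as $(\hat x_{ti},\hat u_{ti})$. 4. Calculate the upper bound $\bar z=c_1\hat x_1+(1-P_2^\ell)\hat u_1+\hat{\mathfrak v}_2$ and $z_i=c_1\hat x_1+(1-P_2^\ell)\hat u_1+\hat{\mathfrak v}_{2i}$, where $\hat{\mathfrak v}_t=\sum_{i=1}^{M_t}\hat{\mathfrak v}_{ti}/M_t$ and, for $t=2,\dots,T$ (with $\hat{\mathfrak v}_{T+1,i}=0$ and $c_{ti}=c_t(\xi_{ti})$), $$\hat{\mathfrak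 v}_{ti}=P_{t+1}^\ell p_{ti}^\ell(c_{ti}\hat x_{ti}+\hat{\mathfrak v}_{t+1,i})+(1-P_{t+1}^\ell)p_{ti}^{u-\ell}\hat u_{ti}+(P_{t+1}^u-P_{t+1}^\ell)p_{ti}^{u-\ell}[c_{ti}\hat x_{ti}+\hat{\mathfrak v}_{t+1,i}-\hat u_{ti}]^+.$$ 5. Backward recursion: for $t=T,T-1,\dots,2$ and each trial decision $(\hat x_{t-1},\hat u_{t-1})=(\hat x_{t-1,i},\hat u_{t-1,i})$, $i=1,\dots,M_t$ (equal to $(\hat x_1,\hat u_1)$ if $t=2$): for each scenario $\xi_{tj}$, $j=1,\dots,N_t$, solve the approximate stage-$t$ problem for $(\hat x_{t-1},\xi_{tj})$ with the current $\mathfrak Q_{t+1}$, and let $\mathbf g_{tj}\in\partial\hat Q_{tj}(\hat x_{t-1})$ be the subgradient obtained from the multiplier associated with the constraints at the optimal solution. With $\mathcal J_t=\{j:\hat Q_{tj}(\hat x_{t-1})>\hat u_{t-1}\}$, construct $$h_t(x,u)=\hat{\mathcal Q}_t(\hat x_{t-1},\hat u_{t-1})+\Big[P_t^\ell\sum_{j=1}^{N_t}p_{tj}^\ell\mathbf g_{tj}+(P_t^u-P_t^\ell)\sum_{j\in\mathcal J_t}p_{tj}^{u-\ell}\mathbf g_{tj}\Big](x-\hat x_{t-1})-(P_t^u-P_t^\ell)|\mathcal J_t|(u-\hat u_{t-1})$$ and update $\mathfrak Q_t:=\max\{\mathfrak Q_t,h_t\}$. 6. Set $k\leftarrow k+1$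 and go to step 2. ''Basic optimal solutions are employed in the backward steps'' refers to using basic optimal solutions of the linear programs solved in step 5 (and hence basic multipliers).
   Formalization: The initial approximations are affine lower bounds of the exact recourse functions instead of 0, which leaves the first problem unbounded in u; in the cuts the u-coefficient uses the total p^{u-l}-weight of J_t instead of the count |J_t|, which gives invalid cuts. *)

(* Defs.v *)
From HB Require Import structures.
From mathcomp Require Import all_boot all_order all_algebra.
From mathcomp Require Import all_classical all_reals all_analysis.

Set Implicit Arguments.
Unset Strict Implicit.
Unset Printing Implicit Defensive.

Import Order.TTheory GRing.Theory Num.Theory.
Import numFieldNormedType.Exports.

Local Open Scope classical_set_scope.
Local Open Scope ring_scope.

(* Stages are numbered 1, ..., nstages.  All the stage-indexed fields are total
   functions of the stage, and only their values at the relevant stages matter.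
   The decision x_t lives in R^(dimx t); the stage-t constraints are
   A_t x_t >= b_t - B_t x_(t-1), so B_t has dimx t.-1 columns. *)
Record rmsp (R : realType) := Rmsp {
  nstages : nat;
  dimx : nat -> nat;
  ncons : nat -> nat;
  nscen : nat -> nat;
  cost1 : 'rV[R]_(dimx 1);
  mat1 : 'M[R]_(ncons 1, dimx 1);
  rhs1 : 'cV[R]_(ncons 1);
  cost : forall t, 'I_(nscen t) -> 'rV[R]_(dimx t);
  matA : forall t, 'I_(nscen t) -> 'M[R]_(ncons t, dimx t);
  matB : forall t, 'I_(nscen t) -> 'M[R]_(ncons t, dimx t.-1);
  rhs : forall t, 'I_(nscen t) -> 'cV[R]_(ncons t);
  refdist : forall t, 'I_(nscen t) -> R;
  tol : nat -> R
}.

Section Problem.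
Variables (R : realType) (D : rmsp R).
Local Notation T := (nstages D).
Local Notation n := (dimx D).
Local Notation N := (nscen D).

Definition random_stage (t : nat) : bool := (2 <= t <= T)%N.

Definition feasible1 : set 'cV[R]_(n 1) :=
  [set x | forall r, rhs1 D r 0 <= (mat1 D *m x) r 0].

Definition feasible t (xbar : 'cV[R]_(n t.-1)) (i : 'I_(N t)) :
    set 'cV[R]_(n t) :=
  [set x | forall r, (rhs i - matB i *m xbar) r 0 <= (matA i *m x) r 0].

(* The stage-t decisions that occur in feasible solutions (stage 0 is a
   placeholder). *)
Fixpoint reach (t : nat) : set 'cV[R]_(n t) :=
  match t return set 'cV[R]_(n t) with
  | 0 => set0
  | t'.+1 =>
      match t' return set 'cV[R]_(n t') -> set 'cV[R]_(n t'.+1) with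
      | 0 => fun=> feasible1
      | s.+1 => fun prev =>
          [set x | exists xbar, exists i : 'I_(N s.+2),
              prev xbar /\ feasible (t := s.+2) xbar i x]
      end (@reach t')
  end.

Definition ambiguity t : set ('I_(N t) -> R) :=
  [set f | [/\ forall i, 0 <= f i,
               forall i, `|f i - refdist i| <= tol D t
             & \sum_i f i = 1]].

Definition worst_case t (v : 'I_(N t) -> \bar R) : \bar R :=
  ereal_sup [set (\sum_i (f i)%:E * v i)%E | f in @ambiguity t].

(* [recourse_rec r t] is the optimal value of the stage-t problem of the
   nested RMSP when r stages remain after stage t. *)
Fixpoint recourse_rec (r t : nat) {struct r} :
    'cV[R]_(n t.-1) -> 'I_(N t) -> \bar R :=
  fun xbar i =>
    ereal_inf [set (((cost i *m x) 0 0)%:E +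
                    match r with
                    | 0 => 0
                    | r'.+1 =>
                        @worst_case t.+1 (fun j => recourse_rec r' (t := t.+1) x j)
                    end)%E | x in feasible xbar i].

Definition recourse t (xbar : 'cV[R]_(n t.-1)) (i : 'I_(N t)) : \bar R :=
  recourse_rec (T - t) xbar i.

Definition cost_to_go t (x : 'cV[R]_(n t)) : \bar R :=
  (if (t < T)%N then @worst_case t.+1 (fun j => @recourse t.+1 x j) else 0)%E.

Definition optimal1 (x : 'cV[R]_(n 1)) : Prop :=
  feasible1 x /\
  forall y, feasible1 y ->
    (((cost1 D *m x) 0 0)%:E + @cost_to_go 1 x <=
     ((cost1 D *m y) 0 0)%:E + @cost_to_go 1 y)%E.

Definition optimal t (xbar : 'cV[R]_(n t.-1)) (i : 'I_(N t))
    (x : 'cV[R]_(n t)) : Prop :=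
  feasible xbar i x /\
  forall y, feasible xbar i y ->
    (((cost i *m x) 0 0)%:E + cost_to_go x <=
     ((cost i *m y) 0 0)%:E + cost_to_go y)%E.

Definition scen_path := forall t, 'I_(N t).

(* A solution of the RMSP is a policy: [pol t xi] is the stage-t decision
   along the scenario path xi.  It is optimal when it attains every one of the
   nested minima. *)
Definition optimal_policy (pol : forall t, scen_path -> 'cV[R]_(n t)) : Prop :=
  (forall xi, optimal1 (pol 1%N xi)) /\
  (forall t xi, random_stage t ->
     optimal (pol t.-1 xi) (xi t) (pol t xi)).

(* Compactness of the feasible set is stated stage by stage. *)
Definition standing_assumption : Prop :=
  [/\ forall t, (1 <= t <= T)%N -> compact (@reach t),
      forall t (xbar : 'cV[R]_(n t.-1)) i, random_stage t ->
        reach xbar -> feasible xbar i !=set0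
    & forall t (xbar : 'cV[R]_(n t.-1)) i, random_stage t ->
        reach xbar -> recourse xbar i \is a fin_num].

Definition f_l t (i : 'I_(N t)) : R := refdist i - tol D t.
Definition f_u t (i : 'I_(N t)) : R := refdist i + tol D t.

(* P_(T+1)^l = P_(T+1)^u = 1. *)
Definition P_l (t : nat) : R :=
  if (t <= T)%N then \sum_(i < N t) f_l i else 1.
Definition P_u (t : nat) : R :=
  if (t <= T)%N then \sum_(i < N t) f_u i else 1.

Definition p_l t (i : 'I_(N t)) : R := f_l i / P_l t.
Definition p_ul t (i : 'I_(N t)) : R := (f_u i - f_l i) / (P_u t - P_l t).

(* Nonnegativity of f_l is what makes p_l a probability vector. *)
Definition reference_assumption : Prop :=
  forall t, random_stage t ->
    [/\ (forall i : 'I_(N t), 0 <= refdist i),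
        \sum_(i < N t) refdist i = 1,
        (forall i : 'I_(N t), 0 <= f_l i),
        0 < P_l t < 1
      & 1 < P_u t].

(* P^l E^l[v] + (P^u - P^l) E^(u-l)[(v - u)^+] *)
Definition risk_value t (v : 'I_(N t) -> \bar R) (u : R) : \bar R :=
  ((P_l t)%:E * (\sum_i (p_l i)%:E * v i) +
   (P_u t - P_l t)%:E * (\sum_i (p_ul i)%:E * maxe (v i - u%:E) 0))%E.

Fixpoint hatQ_rec (r t : nat) {struct r} :
    'cV[R]_(n t.-1) -> 'I_(N t) -> \bar R :=
  fun xbar i =>
    ereal_inf [set (((cost i *m xu.1) 0 0 + (1 - P_l t.+1) * xu.2)%:E +
                    match r with
                    | 0 => 0
                    | r'.+1 =>
                        @risk_value t.+1
                          (fun j => hatQ_rec r' (t := t.+1) xu.1 j) xu.2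
                    end)%E
              | xu in [set xu : 'cV[R]_(n t) * R | feasible xbar i xu.1]].

Definition hat_recourse t (x : 'cV[R]_(n t.-1)) (u : R) : \bar R :=
  risk_value (fun j => hatQ_rec (T - t) x j) u.

End Problem.

Record affine_cut (R : realType) (p : nat) := Cut {
  intercept : R;
  gradient : 'rV[R]_p;
  slope : R
}.
Arguments Cut {R p}.

Definition zero_cut (R : realType) p : affine_cut R p := Cut 0 0 0.

Definition cut_at (R : realType) p (h : affine_cut R p) (x : 'cV[R]_p) (u : R) : R :=
  intercept h + (gradient h *m x) 0 0 + slope h * u.

(* The polyhedral function max_h h(x,u); only nonempty lists are used. *)
Definition max_cuts (R : realType) p (s : seq (affine_cut R p)) (x : 'cV[R]_p) (u : R)
    : R :=
  if s is h0 :: s' then \big[Num.max/cut_at h0 x u]_(h <- s') cut_at h x u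
  else 0.

(* For min {k y : G y >= r} (y free), the pair (y, l) is a basic optimal
   solution with its multiplier: I is a maximal set of linearly independent
   rows of G, y is feasible and tight on I, and l is the dual feasible
   multiplier carried by I. *)
Definition basic_optimal (R : realType) (p q : nat) (G : 'M[R]_(p, q))
    (r : 'cV[R]_p) (k : 'rV[R]_q) (yl : 'cV[R]_q * 'rV[R]_p) : Prop :=
  exists I : {set 'I_p},
    let GI := rowsub (fun a : 'I_#|I| => enum_val a) G in
    [/\ row_free GI && (G <= GI)%MS,
        forall a, r a 0 <= (G *m yl.1) a 0,
        forall a, a \in I -> (G *m yl.1) a 0 = r a 0,
        forall a, 0 <= yl.2 0 a /\ (a \notin I -> yl.2 0 a = 0)
      & yl.2 *m G = k].

Section Algorithm.
Variables (R : realType) (D : rmsp R).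
Local Notation T := (nstages D).
Local Notation n := (dimx D).
Local Notation m := (ncons D).
Local Notation N := (nscen D).

(* [Q t] represents the approximation of the stage-t recourse function of
   (x_(t-1), u_(t-1)). *)
Definition approximation := forall t, seq (affine_cut R (n t.-1)).

Definition approx_optimal1 (s : seq (affine_cut R (n 1))) (xu : 'cV[R]_(n 1) * R)
    : Prop :=
  let obj (z : 'cV[R]_(n 1) * R) :=
    (cost1 D *m z.1) 0 0 + (1 - P_l D 2) * z.2 + max_cuts s z.1 z.2 in
  feasible1 xu.1 /\
  forall z : 'cV[R]_(n 1) * R, feasible1 z.1 -> obj xu <= obj z.

Definition approx_optimal t (s : seq (affine_cut R (n t))) (xbar : 'cV[R]_(n t.-1))
    (i : 'I_(N t)) (xu : 'cV[R]_(n t) * R) : Prop :=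
  let obj (z : 'cV[R]_(n t) * R) :=
    (cost i *m z.1) 0 0 + (1 - P_l D t.+1) * z.2 + max_cuts s z.1 z.2 in
  feasible xbar i xu.1 /\
  forall z : 'cV[R]_(n t) * R, feasible xbar i z.1 -> obj xu <= obj z.

(* The approximate stage-t problem as a linear program in (x, u, theta):
   min c x + (1 - P^l) u + theta subject to A x >= b - B xbar and
   theta - gradient x - slope u >= intercept for every cut. *)
Definition lp_mat t (s : seq (affine_cut R (n t))) (i : 'I_(N t)) :
    'M[R]_(m t + size s, n t + (1 + 1)) :=
  block_mx (matA i) 0
    (\matrix_(l < size s) - gradient (tnth (in_tuple s) l))
    (row_mx (\col_l - slope (tnth (in_tuple s) l)) (const_mx 1)).

Definition lp_rhs t (s : seq (affine_cut R (n t))) (xbar : 'cV[R]_(n t.-1))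
    (i : 'I_(N t)) : 'cV[R]_(m t + size s) :=
  col_mx (rhs i - matB i *m xbar)
    (\col_l intercept (tnth (in_tuple s) l)).

Definition lp_cost t (i : 'I_(N t)) : 'rV[R]_(n t + (1 + 1)) :=
  row_mx (cost i) (row_mx (const_mx (1 - P_l D t.+1)) (const_mx 1)).

(* The linear programming solver: [solve1] and [solve] return (x_t, u_t);
   [solve_basic] returns a solution (x_t, u_t, theta_t) together with the
   multipliers of all the constraints of the linear program. *)
Record solver := Solver {
  solve1 : seq (affine_cut R (n 1)) -> 'cV[R]_(n 1) * R;
  solve : forall t, seq (affine_cut R (n t)) -> 'cV[R]_(n t.-1) -> 'I_(N t) ->
    'cV[R]_(n t) * R;
  solve_basic : forall t (s : seq (affine_cut R (n t))), 'cV[R]_(n t.-1) ->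
    'I_(N t) -> 'cV[R]_(n t + (1 + 1)) * 'rV[R]_(m t + size s)
}.

Variable S : solver.

(* The forward solution (x_t, u_t) along the scenario path xi (stage 0 is a
   placeholder). *)
Fixpoint forward (Q : approximation) (xi : scen_path D) (t : nat) :
    'cV[R]_(n t) * R :=
  match t return 'cV[R]_(n t) * R with
  | 0 => (0, 0)
  | t'.+1 =>
      match t' return 'cV[R]_(n t') * R -> 'cV[R]_(n t'.+1) * R with
      | 0 => fun=> solve1 S (Q 2%N)
      | s.+1 => fun prev => @solve S s.+2 (Q s.+3) prev.1 (xi s.+2)
      end (forward Q xi t')
  end.

(* The stage-t cut at a trial point (x_(t-1), u_(t-1)), where s is the current
   approximation of stage t+1.  The coefficient w of u - u_(t-1) weighs the
   scenarios j with v j > u_(t-1) by p_ul, which makes (g, - w) a subgradient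
   of risk_value at the trial point. *)
Definition new_cut t (s : seq (affine_cut R (n t))) (trial : 'cV[R]_(n t.-1) * R) :
    affine_cut R (n t.-1) :=
  let sol (j : 'I_(N t)) := solve_basic S s trial.1 j in
  let v j := (lp_cost j *m (sol j).1) 0 0 in
  let gj j := - (lsubmx (sol j).2 *m matB j) in
  let g := P_l D t *: (\sum_j p_l j *: gj j) +
    (P_u D t - P_l D t) *: (\sum_(j | trial.2 < v j) p_ul j *: gj j) in
  let w := (P_u D t - P_l D t) * \sum_(j | trial.2 < v j) p_ul j in
  let v0 := fine (risk_value (fun j => (v j)%:E) trial.2) in
  Cut (v0 - (g *m trial.1) 0 0 + w * trial.2) g (- w).

(* Backward recursion from stage T down to stage t, with r = T + 1 - t; xi i is
   the i-th sampled path and M t the number of samples at stage t. *)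
Fixpoint backward_rec (M : nat -> nat) (Q : approximation)
    (xi : nat -> scen_path D) (r t : nat) {struct r} : seq (affine_cut R (n t.-1)) :=
  match r with
  | 0 => Q t
  | r'.+1 =>
      Q t ++ [seq new_cut (backward_rec M Q xi r' t.+1)
                          (forward Q (xi i) t.-1) | i <- iota 0 (M t)]
  end.

Definition backward (M : nat -> nat) (Q : approximation) (xi : nat -> scen_path D)
    : approximation :=
  fun t => backward_rec M Q xi (T.+1 - t) t.

(* The approximations at iteration k, started from the affine functions Q0; the
   paths sampled at iteration k are xi k 0, xi k 1, ...  The upper bound and the
   stopping test never feed back into the approximations, so the iterates are
   those of the algorithm as long as it has not been stopped.
   Q0 t = zero_cut is the simplest initialization, but it leaves the objective
   (1 - P^l) u of the first approximate problems unbounded below in the free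
   variable u; Q0 t (x, u) = L - (1 - P_l t) u with a lower bound L of the
   worst-case expected recourse does not. *)
Fixpoint sddp (M : nat -> nat) (Q0 : forall t, affine_cut R (n t.-1))
    (xi : nat -> nat -> scen_path D) (k : nat) : approximation :=
  match k with
  | 0 => fun t => [:: if (t <= T)%N then Q0 t else zero_cut R (n t.-1)]
  | k'.+1 => backward M (sddp M Q0 xi k') (xi k')
  end.

(* Every linear program of every forward step is solved to optimality, and
   basic optimal solutions are employed in the backward steps, where the
   stage-t problem uses the already updated approximation of stage t+1. *)
Definition solver_correct (M : nat -> nat) (Q0 : forall t, affine_cut R (n t.-1))
    (xi : nat -> nat -> scen_path D) : Prop :=
  forall k,
  [/\ approx_optimal1 (sddp M Q0 xi k 2%N) (solve1 S (sddp M Q0 xi k 2%N)),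
      forall t (xbar : 'cV[R]_(n t.-1)) (i : 'I_(N t)), random_stage D t ->
        reach xbar ->
        let s : seq (affine_cut R (n t)) := sddp M Q0 xi k t.+1 in
        approx_optimal s xbar i (solve S s xbar i)
    & forall t (xbar : 'cV[R]_(n t.-1)) (i : 'I_(N t)), random_stage D t ->
        reach xbar ->
        let s : seq (affine_cut R (n t)) := sddp M Q0 xi k.+1 t.+1 in
        basic_optimal (lp_mat s i) (lp_rhs s xbar i) (lp_cost i)
          (solve_basic S s xbar i)].

End Algorithm.

(* xi k i w t is the scenario drawn for sample i of stage t at iteration k.
   All the draws are mutually independent, the stage-t ones having law q t. *)
Definition independent_sampling (R : realType) (D : rmsp R)
    (M : nat -> nat) (q : forall t, 'I_(nscen D t) -> R)
    (d : measure_display) (W : measurableType d) (P : probability W R)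
    (xi : nat -> nat -> W -> scen_path D) : Prop :=
  let drawn (a : nat * nat * nat) (j : scen_path D) :=
    [set w | xi a.1.1 a.1.2 w a.2 = j a.2] in
  let valid (a : nat * nat * nat) :=
    random_stage D a.2 && (a.1.2 < M a.2)%N in
  (forall a j, valid a -> measurable (drawn a j)) /\
  (forall (s : seq (nat * nat * nat)) (j : nat * nat * nat -> scen_path D),
     uniq s -> all valid s ->
     P (\bigcap_(a in [set` s]) drawn a (j a)) =
     (\prod_(a <- s) q a.2 (j a a.2))%:E).

(* Main.v *)
Require Import Defs.
From HB Require Import structures.
From mathcomp Require Import all_boot all_order all_algebra.
From mathcomp Require Import all_classical all_reals all_analysis.
From mathcomp Require Import measurable_realfun.
From mathcomp Require Import ring lra zify.

Set Implicit Arguments.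
Unset Strict Implicit.
Unset Printing Implicit Defensive.

Import Order.TTheory GRing.Theory Num.Theory.
Import numFieldNormedType.Exports.

Local Open Scope classical_set_scope.
Local Open Scope ring_scope.

(** Why the forward pass is eventually optimal.

    Duality turns the nested worst-case problem into the reformulated one: for
    real scenario values [v], the supremum of [\sum_i f i * v i] over the
    ambiguity set is the minimum over [u] of [(1 - P_l) * u + risk_fin v u].
    Writing [f = f_l + g], this is the duality of a continuous knapsack, whose
    dual optimum [u] is a weighted quantile of [v] ([knapsack_duality]).  Write
    [togo x u] for the exact value function that the cuts approximate.

    Every cut is a lower bound of [togo] by weak duality of the stage linear
    programs ([cuts_valid]).  A basic multiplier is determined by its support, so
    once the cuts of stage t+1 lie in a finite list, so do those of stage t
    ([new_cuts_finite]); by backward induction one finite list contains all the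
    cuts that any sequence of samples can ever produce ([cuts_finite]).  Hence
    the number of distinct cuts is bounded by a constant, and the iterations at
    which it grows are boundedly many.

    If the forward policy of iteration k is not optimal, then at some visited
    point the approximation lies strictly below [togo] ([exact_optimal]).  Take
    such a point with the largest stage s ([last_gap]), on a path p.  The stage
    s+1 subproblems at that point, one for each scenario, are solved by the
    forward decisions of the paths that branch off p after stage s, where the
    approximation of the next stage is exact; so their values are the true
    recourse values and the cut computed there is tight.  If p is the path
    sampled at iteration k, the number of distinct cuts must therefore grow
    ([sampled_gap]).

    The path p depends on the earlier draws only, and the next path is
    independent of them, so p is sampled with conditional probability at least
    some r > 0.  Thus r times the expected number of iterations with a gap is at
    most the bound on the number of cuts, and Borel-Cantelli leaves only finitely
    many such iterations ([bounded_counter_ae]). *)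

(** * Duality for the continuous knapsack *)

Section Quantile.
Variables (R : realType) (I : finType) (w v : I -> R) (kappa : R).
Hypotheses (w_ge0 : forall i, 0 <= w i) (kappa_gt0 : 0 < kappa)
  (kappa_le : kappa <= \sum_i w i).

(** [u] is the smallest value whose strict upper tail weighs at most [kappa].  If
    some value lies below [u], the largest such value has the weak upper tail at
    [u] as its strict upper tail, which by minimality is heavier than [kappa]. *)
Lemma exists_quantile :
  exists u, \sum_(i | u < v i) w i <= kappa <= \sum_(i | u <= v i) w i.
Proof.
have /card_gt0P[i0 _] : (0 < #|I|)%N.
  rewrite lt0n; apply/negP => /eqP/card0_eq I0.
  have := lt_le_trans kappa_gt0 kappa_le.
  by rewrite big1 ?ltxx// => i; have := I0 i.
pose small i := \sum_(j | v i < v j) w j <= kappa.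
have [i1 _ i1max] : {i | predT i & forall j, v j <= v i}.
  by case: (@arg_maxP _ _ _ i0 predT v isT) => i _ h; exists i => // j; exact: h.
have small1 : small i1.
  rewrite /small big_pred0 ?ltW// => j.
  by apply/negbTE; rewrite -leNgt.
case: (arg_minP v small1) => i si imin.
exists (v i); apply/andP; split => //.
have [[k vki]|nok] := pselect (exists k, v k < v i); last first.
  rewrite (le_trans kappa_le)// le_eqVlt; apply/orP; left; apply/eqP.
  apply: eq_bigl => j; apply/esym.
  by rewrite leNgt; apply/negP => h; apply: nok; exists j.
case: (@arg_maxP _ _ _ k (fun j => v j < v i) v vki) => l vli lmax.
rewrite leNgt; apply/negP => hlt.
have sl : small l.
  rewrite /small (eq_bigl (fun j => v i <= v j)) ?ltW// => j.
  apply/idP/idP => [lj|]; last exact: lt_le_trans.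
  by rewrite leNgt; apply/negP => /lmax vjl; have := lt_le_trans lj vjl; rewrite ltxx.
by have := imin _ sl; rewrite leNgt vli.
Qed.

Lemma knapsack_le g u : (forall i, 0 <= g i <= w i) -> \sum_i g i = kappa ->
  \sum_i g i * v i <= kappa * u + \sum_i w i * Num.max (v i - u) 0.
Proof.
move=> gw gk.
rewrite -gk mulr_suml -big_split/=; apply: ler_sum => i _.
have /andP[g0 gwi] := gw i.
rewrite -lerBlDl -mulrBr (le_trans (y := g i * Num.max (v i - u) 0))//.
  by rewrite ler_wpM2l// le_max lexx.
by rewrite ler_wpM2r// le_max lexx orbT.
Qed.

(** The optimal [g] fills the entries above the quantile completely and those
    at the quantile in the same proportion; by complementary slackness the bound
    of [knapsack_le] is then an equality. *)
Lemma knapsack_duality : exists u g,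
  [/\ forall i, 0 <= g i <= w i, \sum_i g i = kappa
    & \sum_i g i * v i = kappa * u + \sum_i w i * Num.max (v i - u) 0].
Proof.
have [u /andP[Alek kleB]] := exists_quantile.
set A := \sum_(i | u < v i) w i in Alek.
pose B := \sum_(i | v i == u) w i.
have AB : \sum_(i | u <= v i) w i = A + B.
  rewrite (bigID (fun i => v i == u))/= addrC; congr (_ + _).
    by apply: eq_bigl => i; rewrite [RHS]lt_neqAle andbC eq_sym.
  by apply: eq_bigl => i; rewrite andbC; case: eqP => // ->; rewrite lexx.
rewrite AB in kleB.
have B0 : 0 <= B by apply: sumr_ge0.
pose th := (kappa - A) / B.
have thB : th * B = kappa - A.
  (* If no weight sits at u, then A = kappa, and th = 0 by x / 0 = 0. *)
  rewrite /th; have [BE|Bn0] := eqVneq B 0; last by rewrite divfK.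
  by rewrite BE mulr0; apply/esym/eqP; rewrite subr_eq0 eq_le Alek -[A]addr0 -BE kleB.
have th01 : 0 <= th <= 1.
  apply/andP; split; first by rewrite divr_ge0// subr_ge0.
  rewrite /th; have [BE|Bn0] := eqVneq B 0; first by rewrite BE invr0 mulr0 ler01.
  by rewrite ler_pdivrMr ?lt_def ?Bn0//; lra.
pose g i := if u < v i then w i else if v i == u then th * w i else 0.
have sumg (F : I -> R) : \sum_i g i * F i =
    \sum_(i | u < v i) w i * F i + th * \sum_(i | v i == u) w i * F i.
  rewrite (bigID (fun i => u < v i))/=; congr (_ + _).
    by apply: eq_bigr => i ui; rewrite /g ui.
  rewrite (bigID (fun i => v i == u))/= addrC big1 ?add0r => [|i /andP[h1 h2]].
    rewrite mulr_sumr; apply: eq_big => [i|i /andP[h1 h2]].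
      by case: eqP => [->|]; rewrite ?ltxx ?andbF.
    by rewrite /g (negbTE h1) h2 mulrA.
  by rewrite /g (negbTE h1) (negbTE h2) mul0r.
have gk : \sum_i g i = kappa.
  under eq_bigr do rewrite -[g _]mulr1.
  by rewrite sumg -!mulr_suml !mulr1 -/A -/B thB addrC subrK.
exists u, g; split => // [i|].
  have /andP[t0 t1] := th01.
  rewrite /g; case: ifP => _; first by rewrite w_ge0 lexx.
  case: ifP => _; last by rewrite lexx w_ge0.
  by rewrite mulr_ge0//= -[leRHS]mul1r ler_wpM2r.
have -> : \sum_i g i * v i = kappa * u + \sum_i g i * (v i - u).
  rewrite -gk mulr_suml -big_split/=; apply: eq_bigr => i _.
  by rewrite -mulrDr addrC subrK.
congr (_ + _); rewrite sumg [X in th * X]big1 => [|i /eqP ->]; last by rewrite subrr mulr0.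
rewrite mulr0 addr0 [RHS](bigID (fun i => u < v i))/= [X in _ = _ + X]big1 ?addr0.
  by apply: eq_bigr => i ui; rewrite max_l// subr_ge0 ltW.
by move=> i ui; rewrite max_r ?mulr0// subr_le0 leNgt.
Qed.

End Quantile.

(** * The risk measure and the exact value functions *)

Section Values.
Variables (R : realType) (D : rmsp R).
Hypotheses (hD : standing_assumption D) (href : reference_assumption D).
Local Notation T := (nstages D).
Local Notation n := (dimx D).
Local Notation N := (nscen D).

Section Stage.
Variables (t : nat) (ht : random_stage D t).

Lemma stage_le : (t <= T)%N. Proof. by case/andP: ht. Qed.

Lemma P_lE : P_l D t = \sum_(i < N t) f_l i.
Proof. by rewrite /P_l stage_le. Qed.

Lemma P_l_gt0 : 0 < P_l D t.
Proof. by case: (href ht) => _ _ _ /andP[]. Qed.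

Lemma P_l_lt1 : P_l D t < 1.
Proof. by case: (href ht) => _ _ _ /andP[]. Qed.

Lemma f_l_ge0 (i : 'I_(N t)) : 0 <= f_l i.
Proof. by case: (href ht) => _ _ h _ _; exact: h. Qed.

Lemma P_ulE : P_u D t - P_l D t = \sum_(i < N t) (f_u i - f_l i).
Proof. by rewrite /P_u /P_l stage_le [RHS]sumrB. Qed.

Lemma P_ul_gt : 1 - P_l D t < P_u D t - P_l D t.
Proof. by case: (href ht) => _ _ _ _ h; rewrite ltrD2r. Qed.

Lemma P_ul_gt0 : 0 < P_u D t - P_l D t.
Proof. by rewrite (lt_trans _ P_ul_gt)// subr_gt0 P_l_lt1. Qed.

(** [P_l < 1 < P_u] makes the total width of the intervals positive, and all
    these widths equal twice the tolerance. *)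
Lemma f_ul_ge0 (i : 'I_(N t)) : 0 <= f_u i - f_l i.
Proof.
have E : f_u i - f_l i = tol D t *+ 2 by rewrite /f_u /f_l; ring.
rewrite E mulrn_wge0//.
have := P_ul_gt0; rewrite P_ulE (eq_bigr (fun=> tol D t *+ 2)) => [|j _]; last first.
  by rewrite /f_u /f_l; ring.
rewrite sumr_const card_ord -mulrnA => h; rewrite leNgt; apply/negP => t0.
by have := lt_le_trans h (mulrn_wle0 (2 * N t) (ltW t0)); rewrite ltxx.
Qed.

(** [risk_value] on real scenario values, with the normalizations of [p_l] and
    [p_ul] cancelled. *)
Definition risk_fin (v : 'I_(N t) -> R) (u : R) : R :=
  \sum_i f_l i * v i + \sum_i (f_u i - f_l i) * Num.max (v i - u) 0.

Lemma risk_valueE v u :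
  risk_value (fun j => (v j)%:E) u = (risk_fin v u)%:E.
Proof.
rewrite /risk_value /risk_fin [RHS]EFinD; congr (_ + _)%E.
  under eq_bigr do rewrite -EFinM.
  rewrite sumEFin -EFinM mulr_sumr; congr EFin; apply: eq_bigr => i _.
  by rewrite mulrA /p_l mulrCA mulfV ?mulr1// gt_eqF// P_l_gt0.
under eq_bigr => i _ do rewrite -EFinB -EFin_max -EFinM.
rewrite sumEFin -EFinM mulr_sumr; congr EFin; apply: eq_bigr => i _.
by rewrite mulrA /p_ul mulrCA mulfV ?mulr1// gt_eqF// P_ul_gt0.
Qed.

Lemma risk_value_le (v v' : 'I_(N t) -> \bar R) u :
  (forall j, v j <= v' j)%E -> (risk_value v u <= risk_value v' u)%E.
Proof.
move=> vv'.
have Pul0 := P_ul_gt0.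
have Pl0 := P_l_gt0.
apply: leeD; apply: lee_wpmul2l; try (by rewrite lee_fin ltW);
  apply: lee_sum => i _; apply: lee_wpmul2l => //.
- by rewrite lee_fin divr_ge0 ?f_l_ge0 ?(ltW Pl0).
- by rewrite lee_fin divr_ge0 ?f_ul_ge0 ?(ltW Pul0).
- by rewrite ge_max !le_max lexx orbT andbT leeB.
Qed.

Lemma risk_fin_le v v' u : (forall j, v j <= v' j) -> risk_fin v u <= risk_fin v' u.
Proof. by move=> h; rewrite -lee_fin -!risk_valueE risk_value_le. Qed.

(** [f - f_l] is a feasible knapsack of capacity [1 - P_l]. *)
Lemma worst_case_le v u :
  (worst_case (fun j : 'I_(N t) => (v j)%:E) <=
   ((1 - P_l D t) * u + risk_fin v u)%:E)%E.
Proof.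
apply: ge_ereal_sup => _ [f [f0 fd f1] <-].
under eq_bigr do rewrite -EFinM.
rewrite sumEFin lee_fin.
pose g i := f i - f_l i.
have gw i : 0 <= g i <= f_u i - f_l i.
  have := fd i; rewrite ler_norml /g /f_u /f_l => /andP[h1 h2].
  by apply/andP; split; lra.
have gk : \sum_i g i = 1 - P_l D t by rewrite sumrB f1 P_lE.
have := @knapsack_le _ _ _ v _ g u gw gk.
under eq_bigr do rewrite /g mulrBl.
rewrite sumrB /risk_fin; lra.
Qed.

(** An optimal knapsack [g] gives the worst distribution [f_l + g], which is
    nonnegative because [f_l] is. *)
Lemma worst_case_attained v : exists u,
  (((1 - P_l D t) * u + risk_fin v u)%:E <=
   worst_case (fun j : 'I_(N t) => (v j)%:E))%E.
Proof.
have k0 : 0 < 1 - P_l D t by rewrite subr_gt0 P_l_lt1.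
have kw : 1 - P_l D t <= \sum_(i < N t) (f_u i - f_l i).
  by rewrite -P_ulE ltW// P_ul_gt.
have [u [g [gw gk gv]]] := knapsack_duality v f_ul_ge0 k0 kw.
exists u; apply: ereal_sup_ubound; exists (fun i => f_l i + g i).
  split => [i|i|].
  - by rewrite addr_ge0 ?f_l_ge0//; case/andP: (gw i).
  - have /andP[] := gw i; rewrite /f_l /f_u ler_norml => h1 h2.
    by apply/andP; split; lra.
  - by rewrite big_split/= gk -P_lE addrC subrK.
under eq_bigr do rewrite -EFinM mulrDl.
by rewrite sumEFin big_split/= gv /risk_fin; congr EFin; ring.
Qed.

End Stage.

Definition recourse_fin t (x : 'cV[R]_(n t.-1)) (i : 'I_(N t)) : R :=
  fine (recourse x i).

Lemma recourse_finE t (x : 'cV[R]_(n t.-1)) i : random_stage D t -> reach x ->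
  recourse x i = (recourse_fin x i)%:E.
Proof. by move=> ht hx; rewrite fineK//; case: hD => _ _; exact. Qed.

(** The function of (x_t, u_t) that the stage-(t+1) cuts approximate.  It is zero
    after the last stage, so that all the stages obey the same recursion. *)
Definition togo t (x : 'cV[R]_(n t)) (u : R) : R :=
  if (t < T)%N then risk_fin (@recourse_fin t.+1 x) u else 0.

Lemma P_l_last : P_l D T.+1 = 1.
Proof. by rewrite /P_l ltnn. Qed.

Lemma cost_to_go_le t (x : 'cV[R]_(n t)) u : (0 < t <= T)%N -> reach x ->
  (cost_to_go x <= ((1 - P_l D t.+1) * u + togo x u)%:E)%E.
Proof.
move=> /andP[t0 tT] rx; rewrite /cost_to_go /togo; case: ltnP => tT'.
  have ht : random_stage D t.+1 by rewrite /random_stage ltnS t0.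
  rewrite (_ : recourse _ = fun j => (@recourse_fin t.+1 x j)%:E) ?worst_case_le//.
  by apply: funext => j; rewrite recourse_finE.
have -> : t = T by apply/eqP; rewrite eqn_leq tT.
by rewrite P_l_last subrr mul0r addr0.
Qed.

Lemma cost_to_go_attained t (x : 'cV[R]_(n t)) : (0 < t <= T)%N -> reach x ->
  exists u, (((1 - P_l D t.+1) * u + togo x u)%:E <= cost_to_go x)%E.
Proof.
move=> /andP[t0 tT] rx; rewrite /cost_to_go /togo; case: ltnP => tT'.
  have ht : random_stage D t.+1 by rewrite /random_stage ltnS t0.
  rewrite (_ : recourse _ = fun j => (@recourse_fin t.+1 x j)%:E).
    exact: worst_case_attained.
  by apply: funext => j; rewrite recourse_finE.
have -> : t = T by apply/eqP; rewrite eqn_leq tT.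
by exists 0; rewrite P_l_last subrr mul0r addr0.
Qed.

Lemma recourseE t (x : 'cV[R]_(n t.-1)) i : (t <= T)%N ->
  recourse x i = ereal_inf [set (((cost i *m y) 0 0)%:E + cost_to_go y)%E | y in feasible x i].
Proof.
move=> tT; rewrite /recourse /cost_to_go.
case E : (T - t)%N => [|r].
  by rewrite /= ltnNge -subn_eq0 E.
by rewrite /= -subn_gt0 E /= /recourse subnS E.
Qed.

Lemma reach_feasible t (x : 'cV[R]_(n t.-1)) i y : random_stage D t ->
  reach x -> feasible x i y -> reach y.
Proof.
case: t x i y => [|[|t]] x i y //= _ rx fy; by exists x, i.
Qed.

Lemma recourse_fin_le t (x : 'cV[R]_(n t.-1)) i (y : 'cV[R]_(n t)) u :
  random_stage D t -> reach x -> feasible x i y ->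
  recourse_fin x i <= (cost i *m y) 0 0 + (1 - P_l D t.+1) * u + togo y u.
Proof.
move=> ht rx fy; have /andP[t2 tT] := ht.
rewrite -lee_fin -recourse_finE// recourseE//.
apply: (le_trans (ereal_inf_lbound _)); first by exists y.
rewrite -addrA EFinD leeD2l// cost_to_go_le ?(ltnW t2)//.
exact: reach_feasible fy.
Qed.

(** The reformulated recourse is at most the nested one: at each stage the
    infimum over [u] may be evaluated at the [u] that attains the worst case.
    This makes lower bounds of [hat_recourse] lower bounds of [togo]. *)
Lemma hat_recourse_le t (x : 'cV[R]_(n t)) u : (0 < t < T)%N ->
  reach x -> (@hat_recourse R D t.+1 x u <= (togo x u)%:E)%E.
Proof.
suff H r s (y : 'cV[R]_(n s.-1)) i : (s + r)%N = T -> random_stage D s ->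
    reach y -> (hatQ_rec r y i <= recourse_rec r y i)%E.
  move=> /andP[t0 tT] rx.
  have ht : random_stage D t.+1 by rewrite /random_stage ltnS t0.
  rewrite /togo tT -risk_valueE// risk_value_le// => j.
  by rewrite -recourse_finE// H// subnKC.
elim: r s y i => [|r IH] s y i sr hs ry.
  apply: le_ereal_inf_tmp => _ [x0 fx <-].
  apply: (le_trans (ereal_inf_lbound _)); first by exists (x0, 0).
  by rewrite /= mulr0 addr0.
apply: le_ereal_inf_tmp => _ [x0 fx <-].
have rx := reach_feasible hs ry fx.
have hs1 : random_stage D s.+1 by rewrite /random_stage -sr; case/andP: hs; lia.
have E : (fun j => recourse_rec r (t := s.+1) x0 j) = fun j => (@recourse_fin s.+1 x0 j)%:E.
  apply: funext => j; rewrite -recourse_finE// /recourse (_ : (T - s.+1)%N = r)//.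
  by rewrite -sr; lia.
rewrite E; have [u0 hu] := worst_case_attained hs1 (@recourse_fin s.+1 x0).
apply: (le_trans (ereal_inf_lbound _)); first by exists (x0, u0).
rewrite /= EFinD -addeA leeD2l// (le_trans _ hu)// EFinD leeD2l//.
rewrite -risk_valueE// -E risk_value_le// => j.
by apply: IH => //; rewrite addSnnS.
Qed.

End Values.

(** * Cuts and the stage linear programs *)

HB.instance Definition _ (R : realType) p := gen_eqMixin (affine_cut R p).
HB.instance Definition _ (R : realType) p := gen_choiceMixin (affine_cut R p).

Section MaxCuts.
Variables (R : realType) (p : nat).
Implicit Types (s : seq (affine_cut R p)) (x : 'cV[R]_p) (u : R).

Lemma cut_le_max_cuts s h x u : h \in s -> cut_at h x u <= max_cuts s x u.
Proof.
case: s => // h0 s; rewrite inE /= => /predU1P[->|]; first exact: bigmax_ge_id.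
by move=> hs; apply: (@le_bigmax_seq _ _ _ _ _ h).
Qed.

Lemma max_cuts_le s x u c : s != [::] ->
  (forall h, h \in s -> cut_at h x u <= c) -> max_cuts s x u <= c.
Proof.
case: s => // h0 s _ hc /=; rewrite big_seq; apply: bigmax_le => [|h hs].
  by apply: hc; rewrite mem_head.
by apply: hc; rewrite inE hs orbT.
Qed.

Lemma max_cuts_sub s s' x u : s != [::] -> {subset s <= s'} ->
  max_cuts s x u <= max_cuts s' x u.
Proof.
by move=> s0 ss'; apply: max_cuts_le => // h /ss'; exact: cut_le_max_cuts.
Qed.

Lemma cut_at_tnth s (l : 'I_(size s)) x u :
  cut_at (tnth (in_tuple s) l) x u <= max_cuts s x u.
Proof. by apply: cut_le_max_cuts; exact: mem_tnth. Qed.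

Lemma zero_cut_at x u : cut_at (zero_cut R p) x u = 0.
Proof. by rewrite /cut_at /= mul0mx mxE mul0r !addr0. Qed.

Lemma mulmxB00 (g : 'rV[R]_p) x y :
  (g *m (x - y)) 0 0 = (g *m x) 0 0 - (g *m y) 0 0.
Proof. by rewrite mulmxBr [LHS]mxE [X in _ + X]mxE. Qed.

Lemma scaled_sum_mulmxE k (P : pred 'I_k) (a : 'I_k -> R) (g : 'I_k -> 'rV[R]_p) x :
  ((\sum_(j | P j) a j *: g j) *m x) 0 0 = \sum_(j | P j) a j * (g j *m x) 0 0.
Proof. by rewrite mulmx_suml summxE; apply: eq_bigr => j _; rewrite -scalemxAl mxE. Qed.

End MaxCuts.

Section CutValue.
Variables (R : realType) (D : rmsp R).
Hypothesis href : reference_assumption D.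
Local Notation T := (nstages D).
Local Notation n := (dimx D).
Local Notation N := (nscen D).
Variables (t : nat) (ht : random_stage D t).

Lemma P_lM_p_l (i : 'I_(N t)) : P_l D t * p_l i = f_l i.
Proof. by rewrite /p_l mulrCA mulfV ?mulr1// gt_eqF// P_l_gt0. Qed.

Lemma P_ulM_p_ul (i : 'I_(N t)) : (P_u D t - P_l D t) * p_ul i = f_u i - f_l i.
Proof. by rewrite /p_ul mulrCA mulfV ?mulr1// gt_eqF// P_ul_gt0. Qed.

(** A new cut of the algorithm is [risk_cut v g xt ut] with [v] the optimal values
    of the scenario problems at the trial point and [g] their subgradients. *)
Definition risk_cut p (v : 'I_(N t) -> R) (g : 'I_(N t) -> 'rV[R]_p)
    (xt : 'cV[R]_p) (ut : R) : affine_cut R p :=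
  let G := P_l D t *: (\sum_j p_l j *: g j) +
    (P_u D t - P_l D t) *: (\sum_(j | ut < v j) p_ul j *: g j) in
  let w := (P_u D t - P_l D t) * \sum_(j | ut < v j) p_ul j in
  Cut (fine (risk_value (fun j => (v j)%:E) ut) - (G *m xt) 0 0 + w * ut) G (- w).

Variables (p : nat) (v : 'I_(N t) -> R) (g : 'I_(N t) -> 'rV[R]_p).
Variables (xt : 'cV[R]_p) (ut : R).

Lemma risk_fin_pos u : risk_fin v u = \sum_i f_l i * v i +
  \sum_(i | u < v i) (f_u i - f_l i) * (v i - u).
Proof.
congr (_ + _); rewrite (bigID (fun i => u < v i))/= [X in _ + X]big1 ?addr0 => [|i ui].
  by apply: eq_bigr => i ui; rewrite max_l// subr_ge0 ltW.
by rewrite max_r ?mulr0// subr_le0 leNgt.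
Qed.

(** The trial point enters a cut only through the set of scenarios above [ut] and
    the numbers [v j - g j xt], the values at 0 of the supporting affine
    functions; this is what makes the cuts finitely many. *)
Lemma risk_cutE : risk_cut v g xt ut =
  let G := \sum_j f_l j *: g j + \sum_(j | ut < v j) (f_u j - f_l j) *: g j in
  Cut (\sum_j f_l j * (v j - (g j *m xt) 0 0) +
       \sum_(j | ut < v j) (f_u j - f_l j) * (v j - (g j *m xt) 0 0))
      G (- \sum_(j | ut < v j) (f_u j - f_l j)).
Proof.
rewrite /risk_cut risk_valueE//= risk_fin_pos.
set G := _ *: _ + _ *: _; have -> : G =
    \sum_j f_l j *: g j + \sum_(j | ut < v j) (f_u j - f_l j) *: g j.
  rewrite /G !scaler_sumr.
  by congr (_ + _); apply: eq_bigr => j _; rewrite scalerA ?P_lM_p_l ?P_ulM_p_ul.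
rewrite mulr_sumr.
have -> : \sum_(i | ut < v i) (P_u D t - P_l D t) * p_ul i =
    \sum_(i | ut < v i) (f_u i - f_l i).
  by apply: eq_bigr => j _; exact: P_ulM_p_ul.
congr Cut.
rewrite mulmxDl mxE !scaled_sum_mulmxE.
under [X in _ = X + _]eq_bigr do rewrite mulrBr.
under [X in _ = _ + X]eq_bigr do rewrite mulrBr.
under [X in _ + X - _ + _ = _]eq_bigr do rewrite mulrBr.
rewrite [X in _ + X - _ + _ = _]sumrB [X in _ = X + _]sumrB [X in _ = _ + X]sumrB.
by rewrite -mulr_suml; ring.
Qed.

Lemma risk_cut_at x u : cut_at (risk_cut v g xt ut) x u =
  \sum_j f_l j * (v j + (g j *m (x - xt)) 0 0) +
  \sum_(j | ut < v j) (f_u j - f_l j) * (v j + (g j *m (x - xt)) 0 0 - u).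
Proof.
rewrite risk_cutE /cut_at /= mulmxDl mxE !scaled_sum_mulmxE mulNr mulr_suml.
rewrite [RHS](_ : _ = \sum_j (f_l j * (v j - (g j *m xt) 0 0) + f_l j * (g j *m x) 0 0) +
  \sum_(j | ut < v j) ((f_u j - f_l j) * (v j - (g j *m xt) 0 0) +
    (f_u j - f_l j) * (g j *m x) 0 0 - (f_u j - f_l j) * u)).
  by rewrite [X in _ = X + _]big_split [X in _ = _ + X]sumrB big_split/=; ring.
by congr (_ + _); apply: eq_bigr => j _; rewrite mulmxB00; ring.
Qed.

Lemma risk_cut_trial : cut_at (risk_cut v g xt ut) xt ut = risk_fin v ut.
Proof.
rewrite risk_cut_at risk_fin_pos subrr.
by congr (_ + _); apply: eq_bigr => j _; rewrite mulmx0 mxE addr0.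
Qed.

(** The positive part is bounded below by its argument on the scenarios above
    [ut] and by 0 on the others. *)
Lemma risk_cut_le v' x u : (forall j, v j + (g j *m (x - xt)) 0 0 <= v' j) ->
  cut_at (risk_cut v g xt ut) x u <= risk_fin v' u.
Proof.
move=> vv'; rewrite risk_cut_at lerD//.
  by apply: ler_sum => j _; rewrite ler_wpM2l// f_l_ge0.
rewrite [leRHS](bigID (fun j => ut < v j))/= -[leLHS]addr0 lerD//.
  apply: ler_sum => j _; rewrite ler_wpM2l ?f_ul_ge0//.
  by rewrite le_max lerB.
by apply: sumr_ge0 => j _; rewrite mulr_ge0 ?f_ul_ge0// le_max lexx orbT.
Qed.

End CutValue.

Section LinearProgram.
Variables (R : realType) (D : rmsp R).
Local Notation n := (dimx D).
Local Notation N := (nscen D).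
Local Notation m := (Defs.ncons D).
Variables (t : nat) (s : seq (affine_cut R (n t))) (i : 'I_(N t)).

Definition lp_point (x : 'cV[R]_(n t)) (u th : R) : 'cV[R]_(n t + (1 + 1)) :=
  col_mx x (col_mx (const_mx u) (const_mx th)).

Lemma lp_pointP (y : 'cV[R]_(n t + (1 + 1))) : exists x u th, y = lp_point x u th.
Proof.
exists (usubmx y), (usubmx (dsubmx y) 0 0), (dsubmx (dsubmx y) 0 0).
rewrite -[LHS]vsubmxK; congr col_mx; rewrite -[LHS]vsubmxK.
by congr col_mx; apply/matrixP => a b; rewrite !ord1 [RHS]mxE.
Qed.

Lemma lp_cost_point x u th : (lp_cost i *m lp_point x u th) 0 0 =
  (cost i *m x) 0 0 + (1 - P_l D t.+1) * u + th.
Proof.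
rewrite /lp_cost /lp_point mul_row_col mul_row_col !mxE !big_ord1 !mxE mul1r.
by rewrite addrA.
Qed.

Lemma lp_mat_point x u th : lp_mat s i *m lp_point x u th =
  col_mx (matA i *m x)
    (\col_l (th - (gradient (tnth (in_tuple s) l) *m x) 0 0
             - slope (tnth (in_tuple s) l) * u)).
Proof.
rewrite /lp_mat /lp_point mul_block_col mul0mx addr0; congr col_mx.
rewrite mul_row_col; apply/matrixP => l b; rewrite ord1 !mxE !big_ord1 !mxE mul1r.
rewrite [X in X + _ = _](_ : _ = - \sum_j gradient (tnth (in_tuple s) l) 0 j * x j 0).
  ring.
by rewrite -sumrN; apply: eq_bigr => j _; rewrite !mxE mulNr.
Qed.

Lemma lp_feasibleP xbar x u th :
  (forall a, lp_rhs s xbar i a 0 <= (lp_mat s i *m lp_point x u th) a 0) <->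
  feasible xbar i x /\
  forall l : 'I_(size s), cut_at (tnth (in_tuple s) l) x u <= th.
Proof.
rewrite lp_mat_point /lp_rhs; split => [H|[H1 H2] a].
  split=> [a|l]; first by have := H (lshift _ a); rewrite !col_mxEu.
  by have := H (rshift _ l); rewrite !col_mxEd [leLHS]mxE [leRHS]mxE /cut_at; lra.
case: (splitP a) => [b ab|b ab].
  by rewrite (_ : a = lshift _ b) ?col_mxEu//; exact: val_inj.
rewrite (_ : a = rshift _ b) ?col_mxEd; last exact: val_inj.
by rewrite [leLHS]mxE [leRHS]mxE; have := H2 b; rewrite /cut_at; lra.
Qed.

Variables (xbar : 'cV[R]_(n t.-1)) (yl : 'cV[R]_(n t + (1 + 1)) * 'rV[R]_(m t + size s)).
Hypothesis yl_opt : basic_optimal (lp_mat s i) (lp_rhs s xbar i) (lp_cost i) yl.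

Lemma lp_value_ge : s != [::] -> exists x u, feasible xbar i x /\
  (cost i *m x) 0 0 + (1 - P_l D t.+1) * u + max_cuts s x u <=
    (lp_cost i *m yl.1) 0 0.
Proof.
move=> s0; case: yl_opt => B [_ fe _ _ _].
have [x [u [th E]]] := lp_pointP yl.1.
move: fe; rewrite E => /lp_feasibleP[fx hc]; exists x, u; split => //.
rewrite lp_cost_point lerD2l; apply: max_cuts_le => // h hs.
by have /tnthP[l ->] : h \in in_tuple s by [].
Qed.

(** Complementary slackness: the multiplier is carried by tight rows. *)
Lemma lp_value_dual : (lp_cost i *m yl.1) 0 0 = (yl.2 *m lp_rhs s xbar i) 0 0.
Proof.
case: yl_opt => B [_ _ tight dual <-]; rewrite -mulmxA !mxE; apply: eq_bigr => a _.
have [/tight->//|aB] := boolP (a \in B).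
by have [_ ->] := dual a; rewrite ?mul0r.
Qed.

(** The multiplier stays dual feasible when [xbar] moves, since [xbar] occurs in
    the right-hand side only; the dual objective is affine in [xbar]. *)
Lemma lp_rhs_shift xbar' : (yl.2 *m lp_rhs s xbar' i) 0 0 =
  (lp_cost i *m yl.1) 0 0 + ((- (lsubmx yl.2 *m matB i)) *m (xbar' - xbar)) 0 0.
Proof.
rewrite lp_value_dual -[yl.2 in LHS]hsubmxK -[yl.2 in X in _ = X + _]hsubmxK.
rewrite /lp_rhs !mul_row_col [LHS]mxE [X in _ = X + _]mxE mulNmx [X in _ = _ + X]mxE.
rewrite !mulmxB00 !mulmxA; ring.
Qed.

Lemma lp_weak_duality xbar' x u : feasible xbar' i x ->
  (lp_cost i *m yl.1) 0 0 + ((- (lsubmx yl.2 *m matB i)) *m (xbar' - xbar)) 0 0 <=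
  (cost i *m x) 0 0 + (1 - P_l D t.+1) * u + max_cuts s x u.
Proof.
move=> fx; rewrite -lp_rhs_shift -lp_cost_point.
case: yl_opt => B [_ _ _ dual <-]; rewrite -mulmxA !mxE; apply: ler_sum => a _.
apply: ler_wpM2l; first by case: (dual a).
by move: a; apply/lp_feasibleP; split => // l; exact: cut_at_tnth.
Qed.

End LinearProgram.

(** * Basic multipliers yield finitely many cuts *)

Section BasicMultipliers.
Variable R : realType.

Definition indep_rows p q (G : 'M[R]_(p, q)) (I : {set 'I_p}) : Prop :=
  forall v : 'rV[R]_p, (forall a, a \notin I -> v 0 a = 0) -> v *m G = 0 -> v = 0.

Lemma row_free_indep p q (G : 'M[R]_(p, q)) (I : {set 'I_p}) :
  row_free (rowsub (fun a : 'I_#|I| => enum_val a) G) -> indep_rows G I.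
Proof.
move=> fG v vI vG.
suff v0 : (\row_(a < #|I|) v 0 (enum_val a)) = 0.
  apply/rowP => a; rewrite mxE; have [aI|/vI//] := boolP (a \in I).
  by move/rowP: v0 => /(_ (enum_rank_in aI a)); rewrite !mxE enum_rankK_in.
apply: (row_free_inj fG); rewrite mul0mx -vG; apply/rowP => c; rewrite !mxE.
rewrite [RHS](bigID (mem I))/= [X in _ = _ + X]big1 ?addr0 => [|a /vI ->]; last by rewrite mul0r.
by rewrite [RHS]big_enum_val/=; apply: eq_bigr => a _; rewrite !mxE.
Qed.

Definition basic_multiplier p q (G : 'M[R]_(p, q)) (k : 'rV[R]_q) (l : 'rV[R]_p) :=
  exists I, [/\ indep_rows G I, forall a, a \notin I -> l 0 a = 0 & l *m G = k].

(** Independence of the rows of the support makes the multiplier unique. *)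
Lemma basic_multipliers_finite p q (G : 'M[R]_(p, q)) (k : 'rV[R]_q) :
  exists L : seq 'rV[R]_p, forall l, basic_multiplier G k l -> l \in L.
Proof.
pose A (I : {set 'I_p}) := [set l : 'rV[R]_p | (forall a, a \notin I -> l 0 a = 0) /\ l *m G = k].
exists [seq xget 0 (A J) | J : {set 'I_p}] => l [I [iI lI lG]].
have -> : l = xget 0 (A I).
  have [xI xG] : A I (xget 0 (A I)) by apply: xgetPex; exists l.
  apply/eqP; rewrite -subr_eq0; apply/eqP/iI.
    by move=> a aI; rewrite mxE [X in _ + X]mxE lI// xI// subrr.
  by rewrite mulmxBl lG xG subrr.
exact: (fintype.image_f (fun J => xget 0 (A J))).
Qed.

Variables (p p' : nat) (phi : 'I_p -> 'I_p').

(** The multiplier on the rows of a larger system that collects at each row the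
    weights of the rows sent to it. *)
Definition push (l : 'rV[R]_p) : 'rV[R]_p' := l *m rowsub phi 1%:M.

Lemma push_mulmx q (B : 'M[R]_(p', q)) l : push l *m B = l *m rowsub phi B.
Proof. by rewrite /push -mulmxA mul_rowsub_mx mul1mx. Qed.

Lemma pushE l b : push l 0 b = \sum_(a | phi a == b) l 0 a.
Proof.
rewrite mxE [RHS]big_mkcond; apply: eq_bigr => a _; rewrite !mxE.
by case: eqP => _; rewrite ?mulr1 ?mulr0.
Qed.

(** Two rows of the support with the same image would be equal rows of the
    smaller system, against independence; hence [phi] is injective on the support
    and its image is again independent. *)
Lemma push_basic q (G : 'M[R]_(p', q)) k l :
  basic_multiplier (rowsub phi G) k l -> basic_multiplier G k (push l).
Proof.
move=> [I [iI lI lG]]; exists (phi @: I); split; last by rewrite push_mulmx.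
- have phi_inj : {in I &, injective phi}.
    move=> a a' aI a'I e; apply/eqP/negPn/negP => naa'.
    have /rowP/(_ a)/eqP : delta_mx 0 a - delta_mx 0 a' = 0 :> 'rV[R]_p.
      apply: iI => [b bI|].
        have ba : (b == a) = false by apply: contraNF bI => /eqP ->.
        have ba' : (b == a') = false by apply: contraNF bI => /eqP ->.
        by rewrite !mxE ba ba' subr0.
      by rewrite mulmxBl -!rowE; apply/rowP => c; rewrite !mxE e subrr.
    by rewrite !mxE !eqxx (negbTE naa') subr0 oner_eq0.
  move=> v vI vG.
  have v0 : \row_a (if a \in I then v 0 (phi a) else 0) = 0 :> 'rV[R]_p.
    apply: iI => [a /negbTE aI|]; first by rewrite mxE aI.
    rewrite -vG; apply/rowP => c; rewrite !mxE.
    rewrite [RHS](bigID (mem (phi @: I)))/= [X in _ = _ + X]big1 ?addr0; last first.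
      by move=> b /vI ->; rewrite mul0r.
    rewrite big_imset//= [LHS](bigID (mem I))/= [X in _ + X]big1 ?addr0.
      by apply: eq_bigr => a aI; rewrite !mxE aI.
    by move=> a /negbTE aI; rewrite !mxE aI mul0r.
  apply/rowP => b; rewrite [RHS]mxE; have [/imsetP[a aI ->]|/vI//] := boolP (b \in phi @: I).
  by move/rowP: v0 => /(_ a); rewrite !mxE aI.
- move=> b bI; rewrite pushE big1// => a /eqP ab; apply: lI.
  by apply: contraNN bI => aI; rewrite -ab imset_f.
Qed.

End BasicMultipliers.

Section FinitelyManyCuts.
Variables (R : realType) (D : rmsp R).
Hypothesis href : reference_assumption D.
Local Notation n := (dimx D).
Local Notation N := (nscen D).
Local Notation m := (Defs.ncons D).

(** The linear program over a list [s] of cuts selects rows of the one over any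
    list [C] containing [s], so its multipliers can be compared on the fixed list
    [C] however long and repetitive [s] is. *)
Section Embedding.
Variables (t : nat) (s C : seq (affine_cut R (n t))) (sC : {subset s <= C}).

Definition cut_rank (l : 'I_(size s)) : 'I_(size C) :=
  Ordinal (etrans (index_mem _ _) (sC (mem_tnth l (in_tuple s)))).

Definition row_rank (a : 'I_(m t + size s)) : 'I_(m t + size C) :=
  match fintype.split a with
  | inl b => lshift _ b
  | inr l => rshift _ (cut_rank l)
  end.

Lemma tnth_cut_rank l : tnth (in_tuple C) (cut_rank l) = tnth (in_tuple s) l.
Proof. by rewrite (tnth_nth (zero_cut R _))/= nth_index// sC// mem_tnth. Qed.

Lemma rowsub_row_rank q (Au : 'M[R]_(m t, q)) (f : affine_cut R (n t) -> 'rV[R]_q) :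
  rowsub row_rank (col_mx Au (\matrix_(l < size C) f (tnth (in_tuple C) l))) =
  col_mx Au (\matrix_(l < size s) f (tnth (in_tuple s) l)).
Proof.
apply/matrixP => a c; rewrite mxE /row_rank -[in RHS](splitK a).
case: (fintype.split a) => b /=; rewrite ?col_mxEu ?col_mxEd// !mxE.
by rewrite tnth_cut_rank.
Qed.

Lemma lp_mat_rowsub i : rowsub row_rank (lp_mat C i) = lp_mat s i.
Proof.
pose f (h : affine_cut R (n t)) : 'rV[R]_(n t + (1 + 1)) :=
  row_mx (- gradient h) (row_mx (const_mx (- slope h)) (const_mx 1)).
have E (s' : seq (affine_cut R (n t))) : lp_mat s' i =
    col_mx (row_mx (matA i) 0) (\matrix_(l < size s') f (tnth (in_tuple s') l)).
  rewrite /lp_mat /block_mx; congr col_mx; apply/matrixP => l c.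
  rewrite [RHS]mxE /f -(splitK c); case: (fintype.split c) => b /=.
    by rewrite !row_mxEl !mxE.
  rewrite !row_mxEr -(splitK b); case: (fintype.split b) => b' /=.
    by rewrite !row_mxEl !mxE.
  by rewrite !row_mxEr !mxE.
by rewrite !E rowsub_row_rank.
Qed.

Lemma lp_rhs_rowsub xbar i : rowsub row_rank (lp_rhs C xbar i) = lp_rhs s xbar i.
Proof.
have E (s' : seq (affine_cut R (n t))) : lp_rhs s' xbar i =
    col_mx (rhs i - matB i *m xbar)
      (\matrix_(l < size s') const_mx (intercept (tnth (in_tuple s') l))).
  by rewrite /lp_rhs; congr col_mx; apply/matrixP => l c; rewrite !mxE.
by rewrite !E (rowsub_row_rank _ (fun h => const_mx (intercept h))).
Qed.

Lemma lsubmx_push q (B : 'M[R]_(m t, q)) l :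
  lsubmx (push row_rank l) *m B = lsubmx l *m B.
Proof.
have E k (l' : 'rV[R]_(m t + k)) : lsubmx l' *m B = l' *m col_mx B 0.
  by rewrite -[in RHS](hsubmxK l') mul_row_col mulmx0 addr0.
rewrite !E push_mulmx; congr (_ *m _).
have E0 (s' : seq (affine_cut R (n t))) : 0 = \matrix_(l < size s') (0 : 'rV[R]_q).
  by apply/matrixP => a b; rewrite !mxE.
by rewrite [in LHS](E0 C) [in RHS](E0 s) (rowsub_row_rank _ (fun=> 0)).
Qed.

End Embedding.

(** A new cut is determined by the set [J] of scenarios above the trial level and,
    for each scenario, a basic multiplier of the linear program over [C]. *)
Lemma new_cuts_finite t (C : seq (affine_cut R (n t))) : random_stage D t ->
  exists C' : seq (affine_cut R (n t.-1)),
  forall (S : solver D) (s : seq (affine_cut R (n t))) (trial : 'cV[R]_(n t.-1) * R),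
    {subset s <= C} ->
    (forall j, basic_optimal (lp_mat s j) (lp_rhs s trial.1 j) (lp_cost j)
       (solve_basic S s trial.1 j)) ->
    new_cut S s trial \in C'.
Proof.
move=> ht.
have [L LP] : exists L : seq 'rV[R]_(m t + size C), forall j l,
    basic_multiplier (lp_mat C j) (lp_cost j) l -> l \in L.
  have /choice[L LP] : forall j : 'I_(N t), exists L : seq 'rV[R]_(m t + size C), forall l,
      basic_multiplier (lp_mat C j) (lp_cost j) l -> l \in L.
    by move=> j; exact: basic_multipliers_finite.
  exists (flatten [seq L j | j : 'I_(N t)]) => j l /LP lL.
  by apply/flattenP; exists (L j) => //; exact: fintype.image_f.
pose F (J : {set 'I_(N t)}) (la : 'I_(N t) -> 'rV[R]_(m t + size C)) :=
  let g j := - (lsubmx (la j) *m matB j) in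
  Cut (\sum_j f_l j * (la j *m lp_rhs C 0 j) 0 0 +
       \sum_(j in J) (f_u j - f_l j) * (la j *m lp_rhs C 0 j) 0 0)
      (\sum_j f_l j *: g j + \sum_(j in J) (f_u j - f_l j) *: g j)
      (- \sum_(j in J) (f_u j - f_l j)).
exists [seq F z.1 (fun j => nth 0 L (z.2 j)) |
         z : {set 'I_(N t)} * {ffun 'I_(N t) -> 'I_(size L).+1}].
move=> S s trial sC basic.
pose sol j := solve_basic S s trial.1 j.
pose v j : R := (lp_cost j *m (sol j).1) 0 0.
pose g j : 'rV[R]_(n t.-1) := - (lsubmx (sol j).2 *m matB j).
pose J := finset (fun j => trial.2 < v j).
pose la j := push (row_rank sC) (sol j).2.
have laL j : la j \in L.
  apply: (LP j); apply: push_basic; rewrite lp_mat_rowsub.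
  have [I [/andP[fG _] _ _ dual lG]] := basic j.
  exists I; split => //; first exact: row_free_indep.
  by move=> a; case: (dual a).
have -> : new_cut S s trial = F J la.
  rewrite -[LHS]/(risk_cut v g trial.1 trial.2) risk_cutE//= /F.
  have E j : v j - (g j *m trial.1) 0 0 = (la j *m lp_rhs C 0 j) 0 0.
    rewrite push_mulmx lp_rhs_rowsub (lp_rhs_shift (basic j)) -/(sol j) -/(v j) -/(g j).
    by rewrite mulmxB00 mulmx0 [X in _ = _ + (X - _)]mxE sub0r.
  have Eg j : - (lsubmx (la j) *m matB j) = g j by rewrite lsubmx_push.
  have EJ j : (j \in J) = (trial.2 < v j) by rewrite inE.
  rewrite !(eq_bigl _ _ EJ); congr Cut; congr (_ + _); apply: eq_bigr => j _;
    by rewrite ?E ?Eg.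
pose fl : {ffun 'I_(N t) -> 'I_(size L).+1} := [ffun j => inord (index (la j) L)].
have -> : F J la =
    F J (fun j => nth 0 L (fl j)).
  congr F; apply: funext => j; rewrite ffunE inordK ?nth_index//.
  by rewrite ltnS index_size.
by apply/mapP; exists (J, fl) => //; rewrite mem_enum.
Qed.

End FinitelyManyCuts.

(** * Exactness along the forward pass *)

Section ForwardPass.
Variables (R : realType) (D : rmsp R).
Hypotheses (hD : standing_assumption D) (href : reference_assumption D).
Local Notation T := (nstages D).
Local Notation n := (dimx D).
Local Notation N := (nscen D).
Variable S : solver D.

Lemma forward_ext (Q Q' : Defs.approximation D) (p p' : scen_path D) t :
  (forall s, (2 <= s)%N -> Q s = Q' s) ->
  (forall s, (2 <= s <= t)%N -> p s = p' s) ->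
  forward S Q p t = forward S Q' p' t.
Proof.
move=> QQ'; elim: t => // -[|t] IH pp'; first by rewrite /= QQ'.
rewrite [LHS]/= [RHS]/= QQ'// pp' ?leqnn// -/(forward S Q p t.+1).
rewrite -/(forward S Q' p' t.+1) IH// => s /andP[s2 st].
by rewrite pp'// s2 (leq_trans st).
Qed.

Definition exact_at (Q : Defs.approximation D) (p : scen_path D) (s : nat) : Prop :=
  let xu := forward S Q p s in
  togo xu.1 xu.2 <= max_cuts (Q s.+1) xu.1 xu.2.

(** A node of path [p] at which the approximation is not exact, in the last stage
    where this happens on any path.  Asking for exactness on all the paths at the
    later stages is what makes every scenario subproblem at that node exact. *)
Definition last_gap (Q : Defs.approximation D) (p : scen_path D) : Prop :=
  exists s, [/\ (0 < s <= T)%N, ~ exact_at Q p s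
    & forall p' s', (s < s' <= T)%N -> exact_at Q p' s'].

Lemma last_gap_ext Q Q' p : (forall s, (2 <= s)%N -> Q s = Q' s) ->
  last_gap Q p -> last_gap Q' p.
Proof.
move=> QQ' [s [/andP[s0 sT] gap exact]]; exists s; rewrite s0 sT.
have E p' s' : (0 < s')%N -> exact_at Q p' s' = exact_at Q' p' s'.
  by move=> s'0; rewrite /exact_at (@forward_ext Q Q' p' p')// QQ'.
split; rewrite // -?E// => p' s' ss'; rewrite -E; first exact: exact.
by case/andP: ss' => /(leq_ltn_trans _)->.
Qed.

Lemma exists_last_gap Q : ~ (forall p s, (0 < s <= T)%N -> exact_at Q p s) ->
  exists p, last_gap Q p.
Proof.
move=> inexact.
pose gap s := `[< (0 < s <= T)%N /\ exists p, ~ exact_at Q p s >].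
have exgap : exists s, gap s.
  apply: contrapT => nogap; apply: inexact => p s s0T.
  by apply: contrapT => ?; apply: nogap; exists s; apply/asboolP; split => //; exists p.
have gap_le s : gap s -> (s <= T)%N by case/asboolP => /andP[].
case: (ex_maxnP exgap gap_le) => s /asboolP[s0T [p gp]] smax.
exists p, s; split => // p' s' /andP[ss' s'T]; apply: contrapT => gp'.
suff /smax : gap s' by rewrite leqNgt ss'.
by apply/asboolP; rewrite s'T (leq_ltn_trans _ ss'); split => //; exists p'.
Qed.

Section OptimalApproximation.
Variable Q : Defs.approximation D.
Hypotheses
  (opt1 : approx_optimal1 (Q 2%N) (solve1 S (Q 2%N)))
  (opt : forall t (xbar : 'cV[R]_(n t.-1)) (i : 'I_(N t)), random_stage D t ->
     reach xbar ->
     approx_optimal (Q t.+1 : seq (affine_cut R (n t))) xbar i (solve S (Q t.+1) xbar i)).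

Lemma forward_reach p t : (0 < t <= T)%N -> reach (forward S Q p t).1.
Proof.
elim: t => // -[|t] IH tT; first by case: opt1.
have ht : random_stage D t.+2 by [].
have rt : reach (forward S Q p t.+1).1 by apply: IH; exact: ltnW tT.
have [fx _] := @opt t.+2 _ (p t.+2) ht rt.
by exists (forward S Q p t.+1).1, (p t.+2).
Qed.

Lemma forward_optimal p t : random_stage D t ->
  approx_optimal (Q t.+1 : seq (affine_cut R (n t))) (forward S Q p t.-1).1 (p t) (forward S Q p t).
Proof.
case: t => [|[|t]] // ht; have /andP[_ /ltnW tT] := ht.
exact: (@opt t.+2 _ (p t.+2) ht (@forward_reach p t.+1 tT)).
Qed.

Hypothesis valid : forall s (x : 'cV[R]_(n s)) u, (0 < s <= T)%N -> reach x ->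
  max_cuts (Q s.+1) x u <= togo x u.

(** For every feasible [y], the total cost of [y] is bounded below by the
    approximate one, hence by that of the forward solution, which is the true one
    by exactness. *)
Lemma exact_optimal : (forall p s, (0 < s <= T)%N -> exact_at Q p s) ->
  (2 <= T)%N -> optimal_policy (fun t p => (forward S Q p t).1).
Proof.
move=> exact T2.
have T1 : (0 < 1 <= T)%N by exact: ltnW T2.
have key s (k : 'rV[R]_(n s)) (xu : 'cV[R]_(n s) * R) (y : 'cV[R]_(n s)) :
    (0 < s <= T)%N -> reach xu.1 -> reach y ->
    togo xu.1 xu.2 <= max_cuts (Q s.+1) xu.1 xu.2 ->
    (forall u, (k *m xu.1) 0 0 + (1 - P_l D s.+1) * xu.2 + max_cuts (Q s.+1) xu.1 xu.2 <=
       (k *m y) 0 0 + (1 - P_l D s.+1) * u + max_cuts (Q s.+1) y u) ->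
    (((k *m xu.1) 0 0)%:E + cost_to_go xu.1 <= ((k *m y) 0 0)%:E + cost_to_go y)%E.
  move=> sT rx ry ex best.
  have [u hu] := cost_to_go_attained hD href sT ry.
  apply: (@le_trans _ _ ((k *m y) 0 0 + ((1 - P_l D s.+1) * u + togo y u))%:E); last first.
    by rewrite EFinD leeD2l.
  apply: (@le_trans _ _ ((k *m xu.1) 0 0 + ((1 - P_l D s.+1) * xu.2 + togo xu.1 xu.2))%:E).
    by rewrite EFinD leeD2l// cost_to_go_le.
  have := best u; have := valid u sT ry; rewrite lee_fin; lra.
split=> [p|t p ht].
  have [f1 best] := opt1; split => // y fy.
  apply: (key 1%N (cost1 D) (solve1 S (Q 2%N))) => // [|u].
  - exact: (exact p 1%N).
  - exact: (best (y, u)).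
have [fx best] := forward_optimal p ht.
have /andP[t2 tT] := ht.
have t0T : (0 < t <= T)%N by rewrite (ltnW t2).
have rx : reach (forward S Q p t.-1).1.
  by apply: forward_reach; case: t t2 tT {ht t0T fx best} => // t t1 /ltnW ->; rewrite andbT.
split => // y fy; apply: key => // [|||u].
- exact: forward_reach.
- exact: reach_feasible fy.
- exact: exact.
- exact: (best (y, u)).
Qed.

End OptimalApproximation.

End ForwardPass.

(** * The iterates *)

Section Iterates.
Variables (R : realType) (D : rmsp R).
Hypotheses (hD : standing_assumption D) (href : reference_assumption D).
Local Notation T := (nstages D).
Local Notation n := (dimx D).
Local Notation N := (nscen D).
Local Notation sample := (nat -> nat -> scen_path D).
Variables (S : solver D) (M : nat -> nat) (Q0 : forall t, affine_cut R (n t.-1)).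

Section Recursion.
Variable xi : sample.
Local Notation Q k := (sddp S M Q0 xi k).

Lemma sddp0 t : (t <= T)%N -> Q 0 t = [:: Q0 t].
Proof. by move=> tT; rewrite /= tT. Qed.

Lemma sddp_gt k t : (T < t)%N -> Q k t = [:: zero_cut R (n t.-1)].
Proof.
move=> tT; elim: k => [|k IH]; first by rewrite /= leqNgt tT.
by rewrite /= /backward (_ : (T.+1 - t)%N = 0%N)//; apply/eqP; rewrite subn_eq0.
Qed.

Lemma max_cuts_last k s (x : 'cV[R]_(n s)) u : s = T ->
  max_cuts (Q k s.+1 : seq (affine_cut R (n s))) x u = 0.
Proof. 
move=> sT; rewrite sddp_gt; last by rewrite sT.
by rewrite /= big_nil zero_cut_at.
Qed.

Lemma togo_last s (x : 'cV[R]_(n s)) u : s = T -> togo x u = 0.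
Proof. by move=> sT; rewrite /togo ifF// sT ltnn. Qed.

Lemma sddpS k t : (t <= T)%N -> Q k.+1 t = Q k t ++
  [seq new_cut S (Q k.+1 t.+1) (forward S (Q k) (xi k i) t.-1) | i <- iota 0 (M t)].
Proof. by move=> tT; rewrite [LHS]/= /backward subSn//= /backward subSS. Qed.

Lemma sddp_neq0 k t : Q k t != [::].
Proof.
have [tT|tT] := leqP t T; last by rewrite sddp_gt.
elim: k => [|k IH]; first by rewrite sddp0.
by rewrite sddpS//; case: (Q k t) IH.
Qed.

Lemma sddp_sub k t : {subset Q k t <= Q k.+1 t}.
Proof.
move=> h; have [tT|tT] := leqP t T; last by rewrite !sddp_gt.
by rewrite sddpS// mem_cat => ->.
Qed.

End Recursion.

(** The iterates are a function of the draws used so far.  The cuts of stage [t]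
    follow path [i < M t] through the earlier stages [s], so [M] must be
    nonincreasing for the draw of stage [s] to be among the [M s] valid ones. *)
Lemma sddp_ext xi xi' k :
  (forall s t, (s <= t <= T)%N -> (2 <= s)%N -> (M t <= M s)%N) ->
  (forall k' i t, (k' < k)%N -> (i < M t)%N -> random_stage D t ->
     xi k' i t = xi' k' i t) ->
  forall t, (2 <= t)%N -> sddp S M Q0 xi k t = sddp S M Q0 xi' k t.
Proof.
move=> Mdec; elim: k => // k IH agree.
have {}IH t : (2 <= t)%N -> sddp S M Q0 xi k t = sddp S M Q0 xi' k t.
  by apply: IH => k' i s k'k; apply: agree; exact: ltnW.
suff H r t : (T.+1 - t)%N = r -> (2 <= t)%N ->
    sddp S M Q0 xi k.+1 t = sddp S M Q0 xi' k.+1 t by move=> t t2; exact: H.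
elim: r t => [|r IHr] t tr t2.
  by rewrite !sddp_gt// -subn_eq0 tr.
have tT : (t <= T)%N by rewrite -ltnS -subn_gt0 tr.
rewrite (sddpS xi k tT) (sddpS xi' k tT) (IH t t2); apply: (congr1 (cat _)).
apply/eq_in_map => i; rewrite mem_iota add0n => /andP[_ iM].
rewrite IHr ?leqW//; last by rewrite subSS; move: tr; rewrite subSn// => -[].
congr new_cut; apply: forward_ext => // s /andP[s2 st].
have sT : (s <= t <= T)%N by rewrite tT (leq_trans st)// leq_pred.
apply: agree => //; first by rewrite (leq_trans iM)// Mdec.
by rewrite /random_stage s2; case/andP: sT => /leq_trans; exact.
Qed.

Lemma solver_basic xi k t xbar (i : 'I_(N t)) : solver_correct S M Q0 xi ->
  random_stage D t -> reach xbar ->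
  let s : seq (affine_cut R (n t)) := sddp S M Q0 xi k.+1 t.+1 in
  basic_optimal (lp_mat s i) (lp_rhs s xbar i) (lp_cost i) (solve_basic S s xbar i).
Proof. by move=> hS ht rx; case: (hS k) => _ _; exact. Qed.

Lemma sddp_forward_reach xi k p t : solver_correct S M Q0 xi -> (0 < t <= T)%N ->
  reach (forward S (sddp S M Q0 xi k) p t).1.
Proof. by move=> hS; case: (hS k) => opt1 opt _; exact: forward_reach. Qed.

(** The list does not depend on the samples: the bound on the number of cuts has
    to be uniform over all outcomes. *)
Lemma cuts_finite : exists C : forall s, seq (affine_cut R (n s)),
  forall xi, solver_correct S M Q0 xi -> forall k s, (0 < s <= T)%N ->
  {subset (sddp S M Q0 xi k s.+1 : seq (affine_cut R (n s))) <= C s}.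
Proof.
suff H s : exists Cs : seq (affine_cut R (n s)), forall xi,
    solver_correct S M Q0 xi -> forall k, (0 < s <= T)%N ->
    {subset (sddp S M Q0 xi k s.+1 : seq (affine_cut R (n s))) <= Cs}.
  exists (fun s => sval (cid (H s))) => xi hS k s sT.
  by case: (cid (H s)) => /= Cs hCs; exact: hCs.
have [r] := ubnP (T - s); elim: r s => // r IH s sr.
have [s0T|/negP s0T] := boolP (0 < s <= T)%N; last by exists [::].
have /andP[s0 sT] := s0T.
have [->|s_lt] := eqVneq s T.
  by exists [:: zero_cut R (n T)] => xi hS k _; rewrite sddp_gt.
have {}sT : (s < T)%N by rewrite ltn_neqAle s_lt.
have [C1 C1P] : exists Cs : seq (affine_cut R (n s.+1)), forall xi,
    solver_correct S M Q0 xi -> forall k, (0 < s.+1 <= T)%N ->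
    {subset (sddp S M Q0 xi k s.+2 : seq (affine_cut R (n s.+1))) <= Cs}.
  by apply: IH; rewrite subnS; move: sr; rewrite -subn_gt0 in sT; case: (T - s)%N sT.
have ht : random_stage D s.+1 by rewrite /random_stage ltnS s0.
have [C' C'P] := new_cuts_finite href C1 ht.
exists (Q0 s.+1 :: C') => xi hS k _; elim: k => [|k IHk] h.
  by rewrite sddp0// inE => /eqP ->; rewrite mem_head.
rewrite sddpS// mem_cat => /orP[/IHk//|/mapP[i _ ->]].
rewrite inE; apply/orP; right; apply: C'P => [h'|j]; first exact: (C1P xi).
by apply: solver_basic => //; apply: sddp_forward_reach.
Qed.

Hypothesis Q0_le : forall t (x : 'cV[R]_(n t.-1)) (u : R), random_stage D t ->
  reach x -> ((cut_at (Q0 t) x u)%:E <= hat_recourse x u)%E.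

Lemma recourse_fin_ge t (x : 'cV[R]_(n t.-1)) i c : random_stage D t -> reach x ->
  (forall y u, feasible x i y -> reach y ->
     c <= (cost i *m y) 0 0 + (1 - P_l D t.+1) * u + togo y u) ->
  c <= recourse_fin x i.
Proof.
move=> ht rx hc; have /andP[t2 tT] := ht.
rewrite -lee_fin -recourse_finE// recourseE//.
apply: le_ereal_inf_tmp => _ [y fy <-].
have ry := reach_feasible ht rx fy.
have [|u hu] := cost_to_go_attained hD href _ ry; first by rewrite (ltnW t2).
rewrite (@le_trans _ _ ((cost i *m y) 0 0 + ((1 - P_l D t.+1) * u + togo y u))%:E)//.
  by rewrite lee_fin addrA hc.
by rewrite EFinD leeD2l.
Qed.

(** Induction on the iteration and, within it, from the last stage backwards, in
    the order in which the cuts are built. *)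
Lemma cuts_valid xi k s (x : 'cV[R]_(n s)) u : solver_correct S M Q0 xi ->
  (0 < s <= T)%N -> reach x ->
  max_cuts (sddp S M Q0 xi k s.+1 : seq (affine_cut R (n s))) x u <= togo x u.
Proof.
move=> hS; elim: k s x u => [|k IHk] s x u s0T rx.
  have /andP[s0 sT] := s0T; move: sT; rewrite leq_eqVlt => /predU1P[sT|sT].
    by rewrite max_cuts_last// togo_last.
  have ht : random_stage D s.+1 by rewrite /random_stage ltnS s0.
  rewrite sddp0//= big_nil -lee_fin; apply: le_trans (Q0_le u ht rx) _.
  by rewrite hat_recourse_le// s0.
have [r] := ubnP (T - s); elim: r s x u s0T rx => // r IH s x u s0T rx sr.
have /andP[s0 sT] := s0T; move: sT; rewrite leq_eqVlt => /predU1P[sT|sT].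
  by rewrite max_cuts_last// togo_last.
have ht : random_stage D s.+1 by rewrite /random_stage ltnS s0.
apply: max_cuts_le => [|h]; first exact: sddp_neq0.
rewrite sddpS// mem_cat => /orP[hQ|/mapP[i _ ->]].
  by rewrite (le_trans (cut_le_max_cuts _ _ hQ))// IHk.
rewrite /togo sT; apply: (risk_cut_le href ht) => j.
set trial := forward _ _ _ _.
have rt : reach trial.1 by exact: sddp_forward_reach.
apply: recourse_fin_ge => // y u' fy ry.
apply: le_trans (lp_weak_duality (solver_basic k j hS ht rt) u' fy) _.
rewrite lerD2l; apply: IH => //.
by rewrite subnS; move: sr; rewrite -subn_gt0 in sT; case: (T - s)%N sT.
Qed.

(** The cut built at the sampled node is tight, and a stalled iteration already
    contained it. *)
Lemma stalled_exact xi k p s : solver_correct S M Q0 xi ->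
  (forall t, random_stage D t -> (0 < M t)%N) ->
  (forall t, random_stage D t -> xi k 0%N t = p t) ->
  (forall t, random_stage D t -> {subset sddp S M Q0 xi k.+1 t <= sddp S M Q0 xi k t}) ->
  (forall p' s', (s < s' <= T)%N -> exact_at S (sddp S M Q0 xi k) p' s') ->
  (0 < s <= T)%N -> exact_at S (sddp S M Q0 xi k) p s.
Proof.
move=> hS M0 xip stalled exact s0T; rewrite /exact_at.
have /andP[s0 sT] := s0T; move: sT; rewrite leq_eqVlt => /predU1P[sT|sT].
  by rewrite max_cuts_last// togo_last.
have ht : random_stage D s.+1 by rewrite /random_stage ltnS s0.
pose Q := sddp S M Q0 xi.
set trial := forward S _ p s.
pose h := new_cut S (Q k.+1 s.+2) trial.
have hQ : h \in Q k s.+1.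
  apply: stalled => //; rewrite sddpS// mem_cat; apply/orP; right.
  apply/mapP; exists 0%N; first by rewrite mem_iota M0.
  rewrite /h; congr new_cut; apply: forward_ext => // t /andP[t2 ts].
  by rewrite xip// /random_stage t2 (leq_trans ts)// ltnW.
have rt : reach trial.1 by exact: sddp_forward_reach.
apply: le_trans (cut_le_max_cuts _ _ hQ).
rewrite [leRHS](risk_cut_trial href ht) /togo sT risk_fin_le// => j.
have [y [u [fy]]] := lp_value_ge (solver_basic k j hS ht rt) (sddp_neq0 _ _ _).
apply: le_trans.
(* The forward pass along p with the draw of stage s+1 replaced by j solves the
   subproblem of scenario j at the trial point. *)
pose pj : scen_path D := @eqtype.dfwith _ _ p s.+1 j.
have trialE : forward S (Q k) pj s = trial.
  by apply: forward_ext => // t /andP[_ ts]; rewrite /pj eqtype.dfwith_out// gtn_eqF.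
have opt : approx_optimal (Q k s.+2 : seq (affine_cut R (n s.+1))) trial.1 j
    (forward S (Q k) pj s.+1).
  case: (hS k) => o1 o2 _.
  by have := forward_optimal o1 o2 pj ht; rewrite /= trialE /pj eqtype.dfwith_in.
have [fx best] := opt.
have := recourse_fin_le hD (forward S (Q k) pj s.+1).2 ht rt fx.
move=> /le_trans; apply.
apply: (le_trans (y := (cost j *m y) 0 0 + (1 - P_l D s.+2) * u + max_cuts (Q k s.+2) y u)).
  apply: le_trans (best (y, u) fy).
  by rewrite lerD2l; apply: (exact pj s.+1); rewrite leqnn.
by rewrite lerD2l max_cuts_sub ?sddp_neq0//; exact: sddp_sub.
Qed.

Definition n_cuts xi k : nat :=
  \sum_(2 <= t < T.+1) size (undup (sddp S M Q0 xi k t)).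

Lemma size_undup_sddp xi k t :
  (size (undup (sddp S M Q0 xi k t)) <= size (undup (sddp S M Q0 xi k.+1 t)))%N.
Proof.
apply: uniq_leq_size; first exact: undup_uniq.
by move=> h; rewrite !mem_undup; exact: sddp_sub.
Qed.

Lemma n_cuts_le xi k : (n_cuts xi k <= n_cuts xi k.+1)%N.
Proof. by apply: leq_sum => t _; exact: size_undup_sddp. Qed.

Lemma n_cuts_stalled xi k : ~~ (n_cuts xi k < n_cuts xi k.+1)%N ->
  forall t, random_stage D t -> {subset sddp S M Q0 xi k.+1 t <= sddp S M Q0 xi k t}.
Proof.
rewrite -leqNgt => stalled t ht h.
have tin : t \in index_iota 2 T.+1 by rewrite mem_index_iota.
suff E : (size (undup (sddp S M Q0 xi k.+1 t)) <= size (undup (sddp S M Q0 xi k t)))%N.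
  rewrite -(mem_undup (sddp S M Q0 xi k.+1 t)) -(mem_undup (sddp S M Q0 xi k t)).
  have sub : {subset undup (sddp S M Q0 xi k t) <= undup (sddp S M Q0 xi k.+1 t)}.
    by move=> h'; rewrite !mem_undup; exact: sddp_sub.
  by have [_ ->] := uniq_min_size (undup_uniq _) sub E.
move: stalled; rewrite /n_cuts !(bigD1_seq t tin (iota_uniq _ _))/=.
set A := (\sum_(_ <- _ | _) _)%N; set B := (\sum_(_ <- _ | _) _)%N => AB.
have BA : (B <= A)%N by apply: leq_sum => s _; exact: size_undup_sddp.
by rewrite -(leq_add2r B) (leq_trans _ AB)// leq_add2l.
Qed.

Lemma n_cuts_bounded : exists K, forall xi, solver_correct S M Q0 xi ->
  forall k, (n_cuts xi k <= K)%N.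
Proof.
have [C CP] := cuts_finite.
exists (\sum_(2 <= t < T.+1) size (C t.-1))%N => xi hS k.
rewrite /n_cuts big_nat_cond [leqRHS]big_nat_cond; apply: leq_sum => -[|t]//.
rewrite ltnS andbT => /andP[t1 tT]; apply: uniq_leq_size; first exact: undup_uniq.
by move=> h; rewrite mem_undup => /(CP _ hS k); apply; rewrite t1 ltnW.
Qed.

Lemma sampled_gap xi k p : solver_correct S M Q0 xi ->
  (forall t, random_stage D t -> (0 < M t)%N) ->
  (forall t, random_stage D t -> xi k 0%N t = p t) ->
  last_gap S (sddp S M Q0 xi k) p -> (n_cuts xi k < n_cuts xi k.+1)%N.
Proof.
move=> hS M0 xip [s [s0T gap exact]]; apply: contrapT => /negP stalled.
apply: gap; apply: stalled_exact => //; exact: n_cuts_stalled.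
Qed.

Lemma not_optimal_gap xi k : solver_correct S M Q0 xi -> (2 <= T)%N ->
  ~ optimal_policy (fun t p => (forward S (sddp S M Q0 xi k) p t).1) ->
  exists p, last_gap S (sddp S M Q0 xi k) p.
Proof.
move=> hS T2 nopt; apply: exists_last_gap => exact; apply: nopt.
have [opt1 opt _] := hS k.
by apply: exact_optimal => // s x u; exact: cuts_valid.
Qed.

End Iterates.

(** * A conditional Borel-Cantelli lemma *)

Section BorelCantelli.
Context d (W : measurableType d) (R : realType) (P : probability W R).

Section CountablePartition.
Variables (I : countType) (h : W -> I).
Hypothesis mh : forall c, measurable (h @^-1` [set c]).

(** Countably many measurable fibers of [h] exhaust such a set. *)
Lemma determined_measurable (E : set W) :
  (forall w w', h w = h w' -> E w -> E w') -> measurable E.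
Proof.
move=> hE.
pose F k := if unpickle k is Some c then
  if `[< exists2 w, E w & h w = c >] then h @^-1` [set c] else set0 else set0.
rewrite (_ : E = \bigcup_k F k).
  apply: bigcup_measurable => k _; rewrite /F.
  by case: unpickle => [c|//]; case: ifP => // _; exact: mh.
apply/seteqP; split => [w Ew|w [k _]].
  exists (pickle (h w)) => //; rewrite /F pickleK ifT//.
  by apply/asboolP; exists w.
rewrite /F; case: unpickle => [c|//]; case: ifP => //.
by move=> /asboolP[w' Ew' hw'] hw; apply: hE Ew'; rewrite hw'.
Qed.

(** A bound on all the conditional probabilities given [h], summed over the fibers
    of [h]. *)
Lemma partition_le (B C : set W) (r : R) : 0 <= r ->
  measurable B -> measurable C ->
  (forall c, r%:E * P (h @^-1` [set c] `&` B) <= P (h @^-1` [set c] `&` C))%E ->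
  (r%:E * P B <= P C)%E.
Proof.
move=> r0 mB mC BC.
pose F k := [set w | pickle (h w) = k].
have FE k : F k = set0 \/ exists c, F k = h @^-1` [set c].
  have [[w Fw]|/set0P/negP/negPn/eqP] := pselect (F k !=set0); last by left.
  right; exists (h w); rewrite /F -Fw; apply/seteqP; split => w' /=.
    exact: (pcan_inj pickleK).
  by move=> ->.
have mF k : measurable (F k) by case: (FE k) => [->|[c ->]].
have PE E : measurable E -> P E = (\sum_(k <oo) P (F k `&` E))%E.
  move=> mE; transitivity (P (\bigcup_k (F k `&` E))).
    congr (P _); rewrite -setI_bigcupl (_ : \bigcup_k F k = setT) ?setTI//.
    by apply/seteqP; split => // w _; exists (pickle (h w)).
  rewrite measure_bigcup//.
  - by apply: eq_eseriesl => k; rewrite in_setT.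
  - by move=> k _; exact: measurableI.
  - by move=> i j _ _ [w [[<- _] [<- _]]].
rewrite (PE B mB) (PE C mC) -nneseriesZl//.
apply: lee_nneseries => k _; first by rewrite mule_ge0.
by case: (FE k) => [->|[c ->]]; rewrite // !set0I measure0 mule0.
Qed.

End CountablePartition.

(** The expected number of growth steps of [C] is at most [K], since it is so
    pointwise; hence the probabilities of the [B k] have sum at most [K / r]. *)
Lemma bounded_counter_ae (B : nat -> set W) (C : nat -> W -> nat) (K : nat) (r : R) :
  0 < r ->
  (forall k, measurable (B k)) ->
  (forall k, measurable [set w | (C k w < C k.+1 w)%N]) ->
  (forall k w, (C k w <= C k.+1 w)%N) -> (forall k w, (C k w <= K)%N) ->
  (forall k, r%:E * P (B k) <= P [set w | (C k w < C k.+1 w)%N])%E ->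
  \forall w \ae P, exists k0, forall k, (k0 <= k)%N -> ~ B k w.
Proof.
move=> r0 mB mC Cmono Cbound BC.
pose I k := [set w | (C k w < C k.+1 w)%N].
have sumI m w : \sum_(0 <= k < m) (\1_(I k) w : R) <= K%:R.
  suff : \sum_(0 <= k < m) (\1_(I k) w : R) <= (C m w)%:R.
    by move=> /le_trans; apply; rewrite ler_nat.
  elim: m => [|m IH]; first by rewrite big_geq.
  rewrite big_nat_recr//= indicE.
  have [/set_mem Iw|nI] := boolP (w \in I m).
    by rewrite (le_trans (lerD IH (lexx _)))// -natrD ler_nat addn1.
  by rewrite addr0 (le_trans IH)// ler_nat.
have sumP m : (\sum_(0 <= k < m) P (I k) <= K%:R%:E)%E.
  have -> : (\sum_(0 <= k < m) P (I k) =
      \int[P]_w (\sum_(0 <= k < m) (\1_(I k) w)%:E))%E.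
    rewrite ge0_integral_sum//.
    - by apply: eq_bigr => k _; rewrite integral_indic ?setIT//; exact: mC.
    - by move=> k; apply/measurable_EFinP/measurable_indic; exact: mC.

  apply: (@le_trans _ _ (\int[P]_w (cst K%:R%:E w))%E); last first.
    by rewrite integral_cst//= probability_setT mule1.
  apply: ge0_le_integral => //.
  - by move=> w _; apply: sume_ge0 => k _; rewrite lee_fin indicE ler0n.
  - by apply: emeasurable_sum => k; apply/measurable_EFinP/measurable_indic; exact: mC.
  - by move=> w _; rewrite sumEFin lee_fin.
have sumB : (\sum_(k <oo) P (B k) < +oo)%E.
  apply: (@le_lt_trans _ _ (r^-1 * K%:R)%:E); last exact: ltry.
  apply: lime_le; first exact: is_cvg_nneseries.
  apply: nearW => m.
  rewrite -(@lee_pmul2l _ r%:E)// ?lte_fin//.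
  rewrite -EFinM mulrA mulfV ?gt_eqF// mul1r ge0_sume_distrr//.
  by rewrite (le_trans _ (sumP m))//; apply: lee_sum => k _; exact: BC.
exists (lim_sup_set B); split.
- by apply: bigcap_measurable => // k _; exact: bigcup_measurable.
- exact: lim_sup_set_cvg0.
- move=> w /= nk k0 _; apply: contrapT => nB; apply: nk; exists k0 => k k0k Bk.
  by apply: nB; exists k.
Qed.

End BorelCantelli.

(** * Histories of draws *)

Section Sampling.
Variables (R : realType) (D : rmsp R) (M : nat -> nat).
Variable q : forall t, 'I_(nscen D t) -> R.
Local Notation T := (nstages D).
Local Notation N := (nscen D).
Context d (W : measurableType d) (P : probability W R).
Variable xi : nat -> nat -> W -> scen_path D.
Hypothesis hxi : independent_sampling M q P xi.
Hypothesis M_gt0 : forall t, random_stage D t -> (0 < M t)%N.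
Hypothesis q_gt0 : forall t, random_stage D t -> forall i : 'I_(N t), 0 < q i.

Local Notation draw := (nat * nat * nat)%type.

Definition past_draws (k : nat) : seq draw :=
  [seq a <- [seq (b, t) | b <- [seq (k', i) | k' <- iota 0 k, i <- iota 0 (\max_(t < T.+1) M t)],
                          t <- iota 0 T.+1] | random_stage D a.2 && (a.1.2 < M a.2)%N].

Definition path_draws (k : nat) : seq draw := [seq ((k, 0%N), t) | t <- index_iota 2 T.+1].

Lemma mem_past_draws k k' i t : ((k', i, t) \in past_draws k) =
  [&& (k' < k)%N, random_stage D t & (i < M t)%N].
Proof.
rewrite mem_filter [X in X && _]/= andbC.
have [ht|] := boolP (random_stage D t); last by rewrite !andbF.
have [iM|] := boolP (i < M t)%N; last by rewrite !andbF.
have /andP[_ tT] := ht.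
rewrite !andbT; apply/allpairsPdep/idP => [[b [t' [/allpairsPdep[k1 [i1 []]]]]]|k'k].
  by rewrite mem_iota /= add0n => + _ -> _ [-> _ _].
exists (k', i), t; rewrite mem_iota/= add0n ltnS tT; split => //.
apply/allpairsPdep; exists k', i; rewrite !mem_iota/= !add0n; split => //.
by rewrite (leq_trans iM)// (leq_bigmax (Ordinal (tT : (t < T.+1)%N))).
Qed.

Lemma past_draws_uniq k : uniq (past_draws k).
Proof.
apply: filter_uniq; apply: allpairs_uniq; rewrite ?iota_uniq//.
  by apply: allpairs_uniq; rewrite ?iota_uniq// => -[? ?] [].
by move=> [? ?] [].
Qed.

Lemma path_draws_uniq k : uniq (past_draws k ++ path_draws k).
Proof.
rewrite cat_uniq past_draws_uniq /path_draws map_inj_uniq ?iota_uniq ?andbT/=.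
  by apply/hasPn => a /mapP[t _ ->]; rewrite mem_past_draws ltnn.
by move=> ? ? [].
Qed.

Lemma draws_valid k :
  all (fun a : draw => random_stage D a.2 && (a.1.2 < M a.2)%N) (past_draws k ++ path_draws k).
Proof.
rewrite all_cat filter_all/=; apply/allP => a /mapP[t + ->].
by rewrite mem_index_iota ltnS => ht /=; rewrite M_gt0 ?andbT.
Qed.

Definition cylinder (s : seq draw) (j : draw -> scen_path D) : set W :=
  [set w | forall a, a \in s -> xi a.1.1 a.1.2 w a.2 = j a a.2].

Lemma cylinderE s j : cylinder s j =
  \bigcap_(a in [set` s]) [set w | xi a.1.1 a.1.2 w a.2 = j a a.2].
Proof. by []. Qed.

(** The draws before iteration [k] as a list of numbers, which lives in a countable
    type although the scenario sets change with the stage. *)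
Definition history (k : nat) (w : W) : seq nat :=
  [seq nat_of_ord (xi a.1.1 a.1.2 w a.2) | a <- past_draws k].

Lemma historyP k w w' : history k w = history k w' <->
  forall a, a \in past_draws k -> xi a.1.1 a.1.2 w a.2 = xi a.1.1 a.1.2 w' a.2.
Proof.
split=> [/eq_in_map h a /h/val_inj//|h].
by apply/eq_in_map => a /h /= ->.
Qed.

Lemma history_cylinder k w0 : history k @^-1` [set history k w0] =
  cylinder (past_draws k) (fun a => xi a.1.1 a.1.2 w0).
Proof. by apply/seteqP; split => w /=; [move/historyP | move=> h; apply/historyP]. Qed.

Lemma measurable_cylinder k j : measurable (cylinder (past_draws k) j).
Proof.
case: hxi => m _; rewrite cylinderE; apply: fin_bigcap_measurable; first exact: finite_seq.
move=> a /=; rewrite mem_filter => /andP[va _]; exact: m.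
Qed.

Lemma measurable_history k c : measurable (history k @^-1` [set c]).
Proof.
have [[w0 /= <-]|h] := pselect (exists w, history k w = c).
  by rewrite history_cylinder; exact: measurable_cylinder.
rewrite (_ : _ @^-1` _ = set0)//; apply/seteqP; split => // w hw.
by apply: h; exists w.
Qed.

Lemma path_probability_gt0 :
  exists2 r, 0 < r & forall p : scen_path D, r <= \prod_(2 <= t < T.+1) q (p t).
Proof.
pose r := \prod_(2 <= t < T.+1) \big[Num.min/1]_(i < N t) q i.
exists r.
  rewrite /r big_nat_cond; apply: prodr_gt0 => t /andP[ht _].
  by apply: lt_bigmin => // i _; exact: q_gt0.
move=> p; rewrite /r big_nat_cond [leRHS]big_nat_cond; apply: ler_prod => t /andP[ht _].
by apply/andP; split; [apply: le_bigmin => // i _; exact/ltW/q_gt0 | exact: bigmin_le].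
Qed.

(** Both events are cylinders over distinct valid draws, and the probability of a
    cylinder is the product over its draws. *)
Lemma next_path_probability k w0 p :
  P (history k @^-1` [set history k w0] `&`
     [set w | forall t, random_stage D t -> xi k 0%N w t = p t]) =
  (P (history k @^-1` [set history k w0]) * (\prod_(2 <= t < T.+1) q (p t))%:E)%E.
Proof.
case: hxi => _ ind.
pose j (a : draw) := if (a.1.1 == k)%N then p else xi a.1.1 a.1.2 w0.
have past_lt a : a \in past_draws k -> (a.1.1 == k)%N = false.
  by case: a => [[k' i] t]; rewrite mem_past_draws => /and3P[k'k _ _]; rewrite /= ltn_eqF.
rewrite (_ : _ `&` _ = cylinder (past_draws k ++ path_draws k) j); last first.
  rewrite history_cylinder; apply/seteqP; split => [w [h hp] a|w h].
    rewrite mem_cat /j => /orP[ak|/mapP[t + ->]].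
      by rewrite past_lt// h.
    by rewrite mem_index_iota ltnS /= eqxx => ht; rewrite hp.
  split=> [a ak|t ht].
    by rewrite h ?mem_cat ?ak// /j past_lt.
  have := h (k, 0%N, t); rewrite /j /= eqxx; apply; rewrite mem_cat; apply/orP; right.
  by apply/mapP; exists t => //; rewrite mem_index_iota ltnS.
have past_valid : all (fun a : draw => random_stage D a.2 && (a.1.2 < M a.2)%N) (past_draws k).
  exact: filter_all.
have -> := ind (past_draws k ++ path_draws k) j (path_draws_uniq k) (draws_valid k).
rewrite history_cylinder.
have -> := ind (past_draws k) (fun a => xi a.1.1 a.1.2 w0) (past_draws_uniq k) past_valid.
rewrite -EFinM big_cat/=; congr ((_ * _)%:E).
  by rewrite big_seq [RHS]big_seq; apply: eq_bigr => a ak; rewrite /j past_lt.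
by rewrite big_map /j /= eqxx.
Qed.

End Sampling.

Theorem proposition2 (R : realType) (D : rmsp R)
    (M : nat -> nat)
    (Q0 : forall t, affine_cut R (dimx D t.-1))
    (S : solver D)
    (q : forall t, 'I_(nscen D t) -> R)
    (d : measure_display) (W : measurableType d) (P : probability W R)
    (xi : nat -> nat -> W -> scen_path D)
    (hT : (2 <= nstages D)%N)
    (hD : standing_assumption D)
    (href : reference_assumption D)
    (hM0 : forall t, random_stage D t -> (0 < M t)%N)
    (hM : forall t, random_stage D t -> random_stage D t.+1 ->
       (M t.+1 <= M t)%N)
    (hQ0 : forall t (x : 'cV[R]_(dimx D t.-1)) (u : R), random_stage D t ->
       reach x -> ((cut_at (Q0 t) x u)%:E <= hat_recourse x u)%E)
    (hq : forall t, random_stage D t ->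
       (forall i : 'I_(nscen D t), 0 < q t i) /\ \sum_(i < nscen D t) q t i = 1)
    (hxi : independent_sampling M q P xi)
    (hS : forall w, solver_correct S M Q0 (fun k i => xi k i w)) :
  \forall w \ae P, exists k0, forall k, (k0 <= k)%N ->
    optimal_policy
      (fun t p => (forward S (sddp S M Q0 (fun k i => xi k i w) k) p t).1).
Proof.
pose X w k i := xi k i w.
have Mdec s t : (s <= t <= nstages D)%N -> (2 <= s)%N -> (M t <= M s)%N.
  move=> /andP[st tT] s2; elim: t st tT => [|t IH]; first by rewrite leqn0 => /eqP ->.
  rewrite leq_eqVlt => /predU1P[->//|]; rewrite ltnS => st tT.
  apply: leq_trans (IH st (ltnW tT)); apply: hM; rewrite /random_stage ?tT ?andbT.
    by rewrite (leq_trans s2 st) ltnW.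
  by rewrite (leq_trans s2)// leqW.
have same_past k w w' : history M xi k w = history M xi k w' ->
    forall t, (2 <= t)%N -> sddp S M Q0 (X w) k t = sddp S M Q0 (X w') k t.
  move=> /historyP e; apply: sddp_ext => // k' i t k'k iM ht.
  by apply: (e (k', i, t)); rewrite mem_past_draws k'k ht.
pose C k w := n_cuts S M Q0 (X w) k.
have CE k w w' : history M xi k w = history M xi k w' -> C k w = C k w'.
  move=> e; rewrite /C /n_cuts big_nat_cond [RHS]big_nat_cond.
  by apply: eq_bigr => t /andP[/andP[t2 _] _]; rewrite (same_past k w w').
have past_sub k w w' : history M xi k.+1 w = history M xi k.+1 w' ->
    history M xi k w = history M xi k w'.
  move=> /historyP e; apply/historyP => -[[k' i] t] h; apply: e; move: h.
  by rewrite !mem_past_draws => /and3P[/ltnW k'k -> ->]; rewrite ltnS k'k.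
(* The event of a gap, unlike that of a non-optimal policy, comes with the path
   to be sampled; it contains the latter by not_optimal_gap. *)
pose B k := [set w | exists p, last_gap S (sddp S M Q0 (X w) k) p].
have mh k c := measurable_history hxi k c.
have mB k : measurable (B k).
  apply: (determined_measurable (mh k)) => w w' e [p gap]; exists p.
  by apply: last_gap_ext gap => t; exact: same_past.
have mC k : measurable [set w | (C k w < C k.+1 w)%N].
  apply: (determined_measurable (mh k.+1)) => w w' e /=.
  by rewrite (CE _ _ _ e) (CE _ _ _ (past_sub _ _ _ e)).
have [K CK] := n_cuts_bounded href S M Q0.
have [r r0 rq] := path_probability_gt0 (fun t ht => (hq t ht).1).
have BC k : (r%:E * P (B k) <= P [set w | (C k w < C k.+1 w)%N])%E.
  apply: (partition_le (mh k)) => //; first exact: ltW.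
  move=> c; have [[w0 [/= h0 [p gap]]]|empty] :=
    pselect ((history M xi k @^-1` [set c] `&` B k) !=set0); last first.
    rewrite (_ : _ `&` B k = set0) ?measure0 ?mule0//.
    by apply/eqP/negPn/negP => /set0P.
  rewrite -h0.
  apply: (@le_trans _ _ (P (history M xi k @^-1` [set history M xi k w0]) * r%:E)%E).
    rewrite muleC; apply: lee_wpmul2r; first by rewrite lee_fin ltW.
    by apply: le_measure; rewrite ?inE//; exact: measurableI.
  apply: (@le_trans _ _ (P (history M xi k @^-1` [set history M xi k w0] `&`
     [set w | forall t, random_stage D t -> xi k 0%N w t = p t]))).
    by rewrite (next_path_probability hxi hM0) lee_wpmul2l// lee_fin.
  have mpath : measurable [set w | forall t, random_stage D t -> xi k 0%N w t = p t].
    apply: (determined_measurable (mh k.+1)) => w w' /historyP e h t ht.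
    by rewrite -h//; apply/esym/(e (k, 0%N, t)); rewrite mem_past_draws ltnSn ht hM0.
  apply: le_measure; rewrite ?inE; [exact: measurableI | exact: measurableI |].
  move=> w [hw wp]; split => //=; apply: (sampled_gap hD href (hS w) hM0 wp).
  by apply: last_gap_ext gap => t; apply: same_past; rewrite hw.
have := bounded_counter_ae r0 mB mC _ _ BC.
move=> /(_ K (fun k w => n_cuts_le _ _ _ _ _) (fun k w => CK _ (hS w) k)).
apply: filterS => w [k0 noB]; exists k0 => k k0k; apply: contrapT => nopt.
by apply: (noB k k0k); apply: not_optimal_gap nopt.
Qed.
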